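(* There is a function $g:\mathbb{N}\times\mathbb{N}\to\mathbb{N}$ such that for all integers $k\ge 0$ and $h\geq 1$, every finite poset $P$ of height $h$ whose cover graph is $k$-planar satisfies $\dim(P)\leq g(k,h)$.
   Context: The height of a poset is the maximum size of a chain. The cover graph of a poset $P$ is the undirected graph on the points of $P$ whose edges are the pairs $\{x,y\}$ with $x<y$ in $P$ and no $z\in P$ with $x<z<y$ in $P$. The dimension $\dim(P)$ is the least $d$ such that there are $d$ linear extensions of $P$ whose intersection is $P$. A graph is $k$-planar if it has a drawing in the plane in which every edge is involved in at most $k$ crossings (with the usual conventions for drawings: vertices are distinct points, edges are simple curves joining their endpoints and containing no other vertices, and any two edges meet in finitely many points, with no three edges crossing at a common point). *)

(* Defs.v *)
From HB Require Import structures.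
From mathcomp Require Import all_boot all_order all_algebra.
From mathcomp Require Import all_classical all_reals all_analysis.

Set Implicit Arguments.
Unset Strict Implicit.
Unset Printing Implicit Defensive.

Import Order.TTheory GRing.Theory Num.Theory.
Import numFieldNormedType.Exports.

Section Poset.
Local Open Scope set_scope.
Variables (d : Order.disp_t) (P : finPOrderType d).
Implicit Types (x y z : P) (L : {set P * P}).

Definition is_chain (C : {set P}) : bool :=
  [forall x in C, forall y in C, (x >=< y)%O].

Definition height : nat := \max_(C : {set P} | is_chain C) #|C|.

Definition covers x y : bool :=
  (x < y)%O && ~~ [exists z, (x < z)%O && (z < y)%O].

(* A graph with vertex set V is given by its set of edges, each of which is a
   two-element subset of V. *)
Definition cover_graph : {set {set P}} :=
  [set A | [exists x, exists y, covers x y && (A == [set x; y])]].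

(* Binary relations on P are sets of pairs: (x, y) is in L when x is below y. *)
Definition order_rel : {set P * P} := [set p | (p.1 <= p.2)%O].

Definition linear_extension L : bool :=
  [&& [forall x, forall y, ((x, y) \in L) && ((y, x) \in L) ==> (x == y)],
      [forall x, forall y, forall z,
         ((x, y) \in L) && ((y, z) \in L) ==> ((x, z) \in L)],
      [forall x, forall y, ((x, y) \in L) || ((y, x) \in L)]
    & order_rel \subset L].

(* Realizers are nonempty families, so that a one-point poset has dimension 1;
   the empty intersection would give it dimension 0. *)
Definition has_realizer (n : nat) : bool :=
  (0 < n)%N &&
  [exists L : {ffun 'I_n -> {set P * P}},
     [forall i, linear_extension (L i)] && (\bigcap_i L i == order_rel)].

(* Ordering P by membership in an up-set U, then by the size of the principal
   down-set, then arbitrarily, gives a linear extension of P. *)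
Definition ext_rank (U : {set P}) z : nat :=
  ((z \in U) * #|P|.+1 + #|[set w : P | (w <= z)%O]|)%N.
Definition ext_key (U : {set P}) z : nat := (ext_rank U z * #|P| + enum_rank z)%N.
Definition key_ext (U : {set P}) : {set P * P} :=
  [set p | (ext_key U p.1 <= ext_key U p.2)%N].

Lemma key_lt U x y : (ext_rank U x < ext_rank U y)%N -> (ext_key U x < ext_key U y)%N.
Proof.
move=> h; rewrite /ext_key; apply: leq_trans (leq_addr _ _).
rewrite -addnS (leq_trans _ (_ : (ext_rank U x).+1 * #|P| <= _)%N) //.
  by rewrite mulSn addnC leq_add2r.
by rewrite leq_mul2r h orbT.
Qed.

Lemma key_inj U : injective (ext_key U).
Proof.
move=> x y e; apply: enum_rank_inj; apply: val_inj => /=.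
have [h|h|h] := ltngtP (ext_rank U x) (ext_rank U y).
- by have := key_lt h; rewrite e ltnn.
- by have := key_lt h; rewrite e ltnn.
- by move: e; rewrite /ext_key h => /addnI.
Qed.

Lemma rank_lt (U : {set P}) x y : (forall z w, z \in U -> (z <= w)%O -> w \in U) ->
  (x < y)%O -> (ext_rank U x < ext_rank U y)%N.
Proof.
move=> upU xy; rewrite /ext_rank -addnS leq_add //.
  rewrite leq_mul2r; case xU: (x \in U); last by rewrite orbT.
  by rewrite (upU x y xU (ltW xy)) orbT.
apply: proper_card; apply/properP; split.
  by apply/fintype.subsetP => w; rewrite !inE => /le_trans; apply; exact: ltW.
by exists y; rewrite !inE ?lexx // lt_geF.
Qed.

Lemma key_ext_linear (U : {set P}) : (forall z w, z \in U -> (z <= w)%O -> w \in U) ->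
  linear_extension (key_ext U).
Proof.
move=> upU; apply/and4P; split.
- apply/forallP => x; apply/forallP => y; rewrite !inE /=.
  by apply/implyP => /anti_leq /key_inj ->.
- apply/forallP => x; apply/forallP => y; apply/forallP => z; rewrite !inE /=.
  by apply/implyP => /andP[]; exact: leq_trans.
- by apply/forallP => x; apply/forallP => y; rewrite !inE /= leq_total.
apply/fintype.subsetP => -[x y]; rewrite !inE /= le_eqVlt => /orP[/eqP ->//|xy].
by apply: ltnW; apply: key_lt; exact: rank_lt.
Qed.

Lemma exists_realizer : exists n, has_realizer n.
Proof.
exists #|P|.+1; apply/andP; split=> //.
pose U (i : 'I_(#|P|.+1)) :=
  [set z : P | [exists w, (enum_rank w == i :> nat) && (w <= z)%O]].
have upU i z w : z \in U i -> (z <= w)%O -> w \in U i.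
  rewrite !inE => /existsP[v /andP[vi vz]] zw; apply/existsP; exists v.
  by rewrite vi (le_trans vz).
apply/existsP; exists [ffun i => key_ext (U i)]; apply/andP; split.
  by apply/forallP => i; rewrite ffunE; apply: key_ext_linear; exact: upU.
apply/eqP/setP => -[x y]; apply/bigcapP/idP => [h|].
  rewrite inE /=; apply/negPn/negP => xy.
  have := h (widen_ord (leqnSn _) (enum_rank x)) isT.
  rewrite ffunE inE /= leqNgt => /negP; apply; apply: key_lt.
  set i := widen_ord _ _.
  have xU : x \in U i by rewrite inE; apply/existsP; exists x; rewrite eqxx lexx.
  have yU : y \notin U i.
    rewrite inE; apply/existsP => -[w /andP[/eqP /= wx wy]].
    by move/ord_inj/enum_rank_inj: wx wy => ->; apply/negP.
  rewrite /ext_rank xU (negPf yU) mul0n add0n mul1n addSn ltnS.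
  by apply: leq_trans (max_card _) _; exact: leq_addr.
move=> xy i _; rewrite ffunE; have /and4P[_ _ _] := key_ext_linear (upU i).
by move/fintype.subsetP/(_ _ xy).
Qed.

Definition poset_dim : nat := ex_minn exists_realizer.

End Poset.

Section Drawing.
Local Open Scope classical_set_scope.
Local Open Scope card_scope.
Local Open Scope ring_scope.
Variables (R : realType) (V : finType) (E : {set {set V}}).

Definition edge_curve (c : {set V} -> R -> R * R) (A : {set V}) : set (R * R) :=
  c A @` `[0, 1].

Definition edge_interior (c : {set V} -> R -> R * R) (A : {set V}) :
  set (R * R) := c A @` `]0, 1[.

(* v places the vertices and c A, restricted to [0, 1], is the curve of the
   edge A. *)
Record is_drawing (v : V -> R * R) (c : {set V} -> R -> R * R) : Prop := {
  drawing_vertices : injective v;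
  drawing_continuous : forall A, A \in E -> {within `[0, 1], continuous (c A)};
  drawing_simple : forall A, A \in E -> set_inj `[0, 1] (c A);
  drawing_endpoints : forall A, A \in E ->
    [set c A 0; c A 1] = v @` [set` A];
  drawing_avoids : forall A x, A \in E -> edge_curve c A (v x) -> x \in A;
  drawing_finite : forall A B, A \in E -> B \in E -> A != B ->
    finite_set (edge_curve c A `&` edge_curve c B);
  drawing_no_triple : forall A B C, A \in E -> B \in E -> C \in E ->
    A != B -> A != C -> B != C ->
    edge_interior c A `&` edge_interior c B `&` edge_interior c C = set0
}.

(* Any common interior point of two distinct edges counts as a crossing, even
   if the edges merely touch there. Since no point lies on three edge
   interiors, distinct crossings on A occur at distinct points. *)
Definition crossings (c : {set V} -> R -> R * R) (A : {set V}) : set (R * R) :=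
  [set p | exists B, [/\ B \in E, B != A &
                         (edge_interior c A `&` edge_interior c B) p]].

Definition k_planar (k : nat) : Prop :=
  exists (v : V -> R * R) (c : {set V} -> R -> R * R),
    is_drawing v c /\ forall A, A \in E -> crossings c A #<= `I_k.

End Drawing.

(* Main.v *)
Require Import Defs.
From mathcomp Require Import all_boot all_order all_algebra.
From mathcomp Require Import boolp.
From mathcomp Require Import zify lra.
From Stdlib Require Import Btauto.

Set Implicit Arguments.
Unset Strict Implicit.
Unset Printing Implicit Defensive.

(** By [k]-planarity, short paths of the cover graph with disjoint interiors
cross few of the others, so a fixed proportion of them is pairwise noncrossing;
these form a graph with no K_{3,3} minor, which therefore has linearly many
edges. Hence the bounded-depth topological minors of the cover graph are sparse,
which bounds its weak coloring numbers (after Zhu and Dvorak), and these bound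
the dimension by the argument of Joret, Micek, Ossona de Mendez and Wiechert:
record, for each color, how the vertices of that color weakly reachable upwards
from [x] and downwards from [y] compare in the vertex order. Incomparable pairs
[(x, y)] with the same record contain no alternating cycle, so one linear
extension reverses them all.

The only topological input is that K_{3,3} has no drawing in which independent
edges are disjoint. It is proved for chains of points with small steps: the
parity of the winding of a difference of two chains around the boundary of a
square of indices vanishes. *)

(** * A mod 2 obstruction to drawing K_{3,3} *)

(** The selected links do not cross one another, but the edges of a single link still may, and links
    with a common end meet there. Once branch sets are contracted, only regions belonging to
    disjoint vertex sets are known to be apart. The van Kampen sum suits this because it mentions
    independent pairs only. Compactness turns disjointness of finitely many pairs of curves into one
    distance [d *+ 2], and connectedness turns curves into chains of steps below [d]; what remains
    is bookkeeping of signs, with no appeal to the Jordan curve theorem.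

    The minor that is excluded is K_6, since density yields clique minors by a short induction;
    three branch sets on each side then give K_{3,3}. *)

Section DiscreteWinding.
Import Order.TTheory GRing.Theory Num.Theory.
Local Open Scope ring_scope.
Variable R : realFieldType.
Implicit Types (p q z w : R * R) (s t : seq (R * R)) (d : R).

Definition nearby d z w := (`|z.1 - w.1| < d) && (`|z.2 - w.2| < d).
Definition far d z w := (d <= `|z.1 - w.1|) || (d <= `|z.2 - w.2|).
Definition dif z w : R * R := (z.1 - w.1, z.2 - w.2).

(** The half-plane is half-open so that exactly one of two opposite nonzero vectors is upper. *)
Definition upper z := (0 < z.2) || ((z.2 == 0) && (0 < z.1)).

(* The parity of the number of crossings of the step from [z] to [w] with the
   negative half of the first axis, meaningful when both points lie in one of
   the four open half-planes bounded by a coordinate axis. *)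
Definition cross z w := (upper z (+) upper w) && (z.1 < 0).

Fixpoint turn (f : R * R -> R * R) z s :=
  if s is w :: s' then cross (f z) (f w) (+) turn f w s' else false.

Lemma upper_same_sign d z w : 0 < d -> d <= `|z.2| -> nearby d z w ->
  upper z = upper w.
Proof.
rewrite /nearby /upper => d0 dz /andP[_]; rewrite ltr_norml => /andP[a b].
case/orP: (le_total z.2 0) => z0.
  rewrite (ler0_norm z0) in dz.
  have -> : (0 < z.2) = false by apply/negbTE; rewrite -leNgt.
  have -> : (z.2 == 0) = false by apply/negbTE/eqP; lra.
  have -> : (0 < w.2) = false by apply/negbTE; rewrite -leNgt; lra.
  by have -> : (w.2 == 0) = false by apply/negbTE/eqP; lra.
rewrite (ger0_norm z0) in dz.
have -> : 0 < z.2 by lra.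
by have -> : 0 < w.2 by lra.
Qed.

Lemma neg_same_sign d z w : 0 < d -> d <= `|z.1| -> nearby d z w ->
  (z.1 < 0) = (w.1 < 0).
Proof.
rewrite /nearby => d0 dz /andP[+ _]; rewrite ltr_norml => /andP[a b].
case/orP: (le_total z.1 0) => z0.
  by rewrite (ler0_norm z0) in dz; apply/idP/idP; lra.
by rewrite (ger0_norm z0) in dz; apply/idP/idP; lra.
Qed.

(** All four points lie on the same side of one of the axes, in a half-plane without the origin, so
    the parity from [z] to [y] does not depend on the route. *)
Lemma cross_cell d z w x y : 0 < d -> far d z (0, 0) ->
  nearby d z w -> nearby d z x -> nearby d z y ->
  cross z w (+) cross w y = cross z x (+) cross x y.
Proof.
rewrite /far /= !subr0 => d0 /orP[dz|dz] zw zx zy; rewrite /cross.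
  rewrite -(neg_same_sign d0 dz zw) -(neg_same_sign d0 dz zx).
  by case: (z.1 < 0); rewrite ?andbF ?andbT // !addbA
    -!(addbC (upper w)) !addbA addbb -!(addbC (upper x)) !addbA addbb.
rewrite -(upper_same_sign d0 dz zw) -(upper_same_sign d0 dz zx).
by rewrite -(upper_same_sign d0 dz zy) addbb.
Qed.

Lemma upper_opp p q : p <> q -> upper (dif p q) = ~~ upper (dif q p).
Proof.
case: p q => [a b] [c e] ne; rewrite /upper /dif /=.
have -> : (e - b == 0) = (b - e == 0) by rewrite !subr_eq0 eq_sym.
have -> : (0 < e - b) = (b - e < 0) by rewrite subr_gt0 subr_lt0.
have -> : (0 < c - a) = (a - c < 0) by rewrite subr_gt0 subr_lt0.
case: (ltrgt0P (b - e)) => //= /eqP; rewrite subr_eq0 => /eqP be.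
case: (ltrgt0P (a - c)) => //= /eqP; rewrite subr_eq0 => /eqP ac.
by case: ne; rewrite ac be.
Qed.

Lemma far_neq d z w : 0 < d -> far d z w -> z <> w.
Proof.
by move=> d0 f e; move: f; rewrite /far e !subrr normr0 orbb leNgt d0.
Qed.

Lemma farC d z w : far d z w = far d w z.
Proof. by rewrite /far distrC (distrC z.2). Qed.

(** Negating a step exchanges the two halves of the first axis. Together the two terms count
    crossings of the whole axis, which is the change of [upper]. *)
Lemma cross_opp d a z w : 0 < d -> far d a z -> far d a w -> nearby d z w ->
  cross (dif z a) (dif w a) (+) cross (dif a z) (dif a w) =
  upper (dif z a) (+) upper (dif w a).
Proof.
move=> d0 az aw zw; rewrite /cross.
rewrite (upper_opp (far_neq d0 az)) (upper_opp (far_neq d0 aw)).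
have -> : (dif a z).1 < 0 = (0 < (dif z a).1) by rewrite /= subr_lt0 subr_gt0.
have [e|ne] := eqVneq (upper (dif z a)) (upper (dif w a)).
  by rewrite e !addbb.
have : ~~ (d <= `|(dif z a).2|).
  apply/negP => dz; case/negP: ne; apply/eqP.
  apply: (upper_same_sign d0 dz); move: zw; rewrite /nearby /dif /=.
  by rewrite !opprB !addrA !subrK.
move: az; rewrite farC /far /= => /orP[|->//] dz _.
have n0 : z.1 - a.1 != 0 by rewrite -normr_gt0 (lt_le_trans d0).
have -> : (z.1 - a.1 < 0) = ~~ (0 < z.1 - a.1).
  by rewrite -leNgt le_eqVlt (negPf n0).
by case: (upper (dif z a)); case: (upper (dif w a)); case: (0 < z.1 - a.1).
Qed.

(** This doubling is the source of the separation [d *+ 2] required between chains of step [d]. *)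
Lemma nearby_dif d z z' w w' : nearby d z z' -> nearby d w w' ->
  nearby (d *+ 2) (dif z w) (dif z' w').
Proof.
rewrite /nearby /dif /= mulr2n => /andP[a b] /andP[a' b'].
have H (x y x' y' : R) : `|x - x'| < d -> `|y - y'| < d ->
    `|x - y - (x' - y')| < d + d.
  move=> h k; apply: le_lt_trans (ltrD h k).
  have -> : x - y - (x' - y') = (x - x') - (y - y') by lra.
  exact: ler_normB.
by rewrite !H.
Qed.

Lemma nearby_refl d z : 0 < d -> nearby d z z.
Proof. by rewrite /nearby !subrr normr0 => ->. Qed.

Lemma nearby_weak d e z w : d <= e -> nearby d z w -> nearby e z w.
Proof. by rewrite /nearby => de /andP[a b]; rewrite !(lt_le_trans _ de). Qed.

Lemma nearbyC d z w : nearby d z w = nearby d w z.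
Proof. by rewrite /nearby distrC (distrC z.2). Qed.

Lemma far_dif d z w : far d (dif z w) (0, 0) = far d z w.
Proof. by rewrite /far /= !subr0. Qed.

Lemma turn_step d p s z w : 0 < d -> path (nearby d) p s -> nearby d z w ->
  {in p :: s, forall x, far (d *+ 2) x z} ->
  turn (dif^~ z) p s (+) cross (dif (last p s) z) (dif (last p s) w) =
  cross (dif p z) (dif p w) (+) turn (dif^~ w) p s.
Proof.
move=> d0; elim: s p => [|x s IH] p /=; first by rewrite addbF.
move=> /andP[px xs] zw H.
have {}IH := IH x xs zw (fun y yi => H y (mem_behead (s := p :: x :: s) yi)).
have d20 : 0 < d *+ 2 by rewrite mulrn_wgt0.
have pz : far (d *+ 2) (dif p z) (0, 0) by rewrite far_dif H ?mem_head.
have E := cross_cell d20 pz (nearby_dif px (nearby_refl z d0))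
  (nearby_dif (nearby_refl p d0) zw) (nearby_dif px zw).
by rewrite addbA -E -!addbA IH.
Qed.

(** The differences of the two chains form a grid that avoids the origin. Each unit cell has zero
    winding by [cross_cell], hence so has the boundary of the grid. *)
Lemma turn_square d p s q t : 0 < d -> path (nearby d) p s -> path (nearby d) q t ->
  {in p :: s & q :: t, forall x y, far (d *+ 2) x y} ->
  turn (dif^~ q) p s (+) turn (dif^~ (last q t)) p s =
  turn (dif p) q t (+) turn (dif (last p s)) q t.
Proof.
move=> d0 ps; elim: t q => [|y t IH] q /=; first by rewrite addbb.
move=> /andP[qy yt] H.
have {}IH := IH y yt (fun a b ai bi => H a b ai (mem_behead (s := q :: y :: t) bi)).
have E := turn_step d0 ps qy (fun x xi => H x q xi (mem_head _ _)).
move: E IH; set c1 := cross _ _; set c2 := cross _ _.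
set t1 := turn _ _ _; set t2 := turn _ _ _; set t3 := turn _ _ _.
set t4 := turn _ _ _; set t5 := turn _ _ _.
by case: c1; case: c2; case: t1; case: t2; case: t3; case: t4; case: t5.
Qed.

Lemma turn_opp d a q t : 0 < d -> path (nearby d) q t ->
  {in q :: t, forall x, far (d *+ 2) a x} ->
  turn (dif a) q t =
  turn (dif^~ a) q t (+) (upper (dif q a) (+) upper (dif (last q t) a)).
Proof.
move=> d0; elim: t q => [|y t IH] q /=; first by rewrite addbb.
move=> /andP[qy yt] H.
rewrite IH //; last by move=> x xi; apply: H; rewrite inE xi orbT.
have d20 : 0 < d *+ 2 by rewrite mulrn_wgt0.
have qy2 : nearby (d *+ 2) q y.
  by apply: nearby_weak qy; rewrite mulr2n lerDl ltW.
have := cross_opp d20 (H q (mem_head _ _)) _ qy2.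
rewrite (H y) ?inE ?eqxx ?orbT // => /(_ isT).
set u1 := upper _; set u2 := upper (dif y a); set u3 := upper _.
set c1 := cross _ _; set c2 := cross _ _; set t1 := turn _ _ _.
by case: u1; case: u2; case: u3; case: c1; case: c2; case: t1.
Qed.

(** A formal identity in [X] and [u]. Fixing an edge and one end of an edge independent of it leaves
    two choices for the other end, so each [X] term occurs twice. The [u] terms involving some [a]
    occur an even number of times as well, but [u (b j') (b j)] occurs once for each of the three
    pairs of indices of [a], and survives. *)
Lemma K33_parity (T : Type) (a b : 'I_3 -> T) (X : 'I_3 -> 'I_3 -> T -> bool)
    (u : T -> T -> bool) (o0 o1 o2 : 'I_3) :
  let L i j i' j' :=
    X i j (a i') (+) X i j (b j') (+) X i' j' (a i) (+) X i' j' (b j) (+)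
    (u (a i') (a i) (+) u (b j') (a i) (+) (u (a i') (b j) (+) u (b j') (b j))) in
  let M i i' :=
    L i o0 i' o1 (+) L i o1 i' o0 (+) (L i o0 i' o2 (+) L i o2 i' o0) (+)
    (L i o1 i' o2 (+) L i o2 i' o1) in
  M o0 o1 (+) M o0 o2 (+) M o1 o2 =
  (u (b o0) (b o1) (+) u (b o1) (b o0)) (+) (u (b o0) (b o2) (+) u (b o2) (b o0))
  (+) (u (b o1) (b o2) (+) u (b o2) (b o1)).
Proof.
have addbE x y : x (+) y = xorb x y by case: x; case: y.
by rewrite /= !addbE; btauto.
Qed.

(* The mod 2 van Kampen obstruction: summing [turn_square] over the 18 pairs of
   independent edges of K_{3,3}, every winding parity occurs twice, while the
   half-plane terms add up to 1. *)
Lemma no_fine_K33 d (a b : 'I_3 -> R * R) (t : 'I_3 -> 'I_3 -> seq (R * R)) :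
  0 < d ->
  (forall i j, path (nearby d) (a i) (t i j) /\ last (a i) (t i j) = b j) ->
  (forall i j i' j', i != i' -> j != j' ->
     {in a i :: t i j & a i' :: t i' j', forall x y, far (d *+ 2) x y}) ->
  False.
Proof.
move=> d0 P F.
pose X i j c := turn (dif^~ c) (a i) (t i j).
pose u p q := upper (dif p q).
have E i j i' j' : i != i' -> j != j' ->
    X i j (a i') (+) X i j (b j') (+) X i' j' (a i) (+) X i' j' (b j) (+)
    (u (a i') (a i) (+) u (b j') (a i) (+) (u (a i') (b j) (+) u (b j') (b j)))
    = false.
  move=> ii jj; have [p1 l1] := P i j; have [p2 l2] := P i' j'.
  have H := F _ _ _ _ ii jj.
  have lm p s : last p s \in p :: s by rewrite mem_last.
  have := turn_square d0 p1 p2 H.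
  rewrite (turn_opp d0 p2 (fun x => H _ x (mem_head _ _))).
  rewrite (turn_opp d0 p2 (fun x => H _ x (lm _ _))).
  rewrite l1 l2 -/(X i j (a i')) -/(X i j (b j')) -/(X i' j' (a i)).
  rewrite -/(X i' j' (b j)) -!/(u _ _).
  move: (X i j _) (X i j _) (X i' j' _) (X i' j' _) => x1 x2 x3 x4.
  move: (u _ _) (u _ _) (u _ _) (u _ _) => u1 u2 u3 u4.
  by case: x1; case: x2; case: x3; case: x4; case: u1; case: u2; case: u3; case: u4.
have ub j j' : j != j' -> u (b j) (b j') (+) u (b j') (b j) = true.
  move=> jj; have [_ l1] := P ord0 j; have [_ l2] := P ord_max j'.
  have ne : b j <> b j'.
    rewrite -l1 -l2; apply: (far_neq (d := d *+ 2)); first by rewrite mulrn_wgt0.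
    by apply: (F ord0 j ord_max j' isT jj); exact: mem_last.
  by rewrite /u (upper_opp ne) addNb addbb.
have := K33_parity a b X u ord0 (lift ord0 ord0) ord_max.
by rewrite /= !E // !ub.
Qed.

End DiscreteWinding.

(** * Dense graphs have clique minors *)

Section CliqueMinors.
Variable T : finType.
Implicit Types (D A : {set T}) (e : rel T).

Definition induced e A : rel T := fun a b => [&& e a b, a \in A & b \in A].

Definition joined e A := forall x y, x \in A -> y \in A -> connect (induced e A) x y.

Definition deg_sum e D := #|[set p : T * T | induced e D p.1 p.2]|.

Definition clique_minor t e D := exists B : nat -> {set T},
  (forall i, i < t -> [/\ B i \subset D, B i != set0 & joined e (B i)]) /\
  (forall i j, i < j < t -> (forall x, x \in B i -> x \notin B j) /\
     exists x y, [/\ x \in B i, y \in B j & e x y]).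

(** Contracting an edge that lies in at most [m] triangles costs one vertex and at most [2 * m.+1]
    ordered adjacent pairs, so a density of [2 * m + 2] survives it. *)
Fixpoint minor_density t := if t is t'.+1 then 2 * minor_density t' + 2 else 0.

(* [v] is merged into [u]; it has to be removed from the vertex set separately. *)
Definition contract e u v : rel T :=
  fun x y => (x != y) && [|| e x y, (x == u) && e v y | (y == u) && e v x].

Lemma contract_sym e u v : symmetric e -> symmetric (contract e u v).
Proof.
by move=> se x y; rewrite /contract /= eq_sym se; congr (_ && (_ || _)); rewrite orbC.
Qed.

Lemma deg_sum_contract e D u v : symmetric e -> irreflexive e ->
  u \in D -> v \in D -> e u v ->
  deg_sum e D <= deg_sum (contract e u v) (D :\ v) +
    2 * #|[set y in D | e u y && e v y]|.+1.
Proof.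
move=> se ie uD vD euv; have uv : u != v by apply: contraTneq euv => ->; rewrite ie.
(* The lost pairs are those joining [v] to [u] or to a common neighbor. On all other pairs, renaming
   [v] to [u] is injective and lands in the contracted graph. *)
set C := [set y in D | _]; pose Z := u |: C.
pose bad := [set (v, y) | y in Z] :|: [set (y, v) | y in Z].
rewrite /deg_sum; set P := [set p : T * T | induced e D p.1 p.2].
set P' := [set p : T * T | induced (contract e u v) (D :\ v) p.1 p.2].
have cZ : #|Z| <= #|C|.+1 by rewrite cardsU1; case: (_ \in _).
have cb : #|bad| <= 2 * #|C|.+1.
  apply: leq_trans (leq_card_setU _ _) _.
  by rewrite mul2n -addnn leq_add // (leq_trans (leq_imset_card _ _)).
pose f x := if x == v then u else x.
have mem_bad x y : ((x, y) \in bad) =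
    ((x == v) && (y \in Z)) || ((y == v) && (x \in Z)).
  rewrite inE; congr (_ || _).
    apply/imsetP/andP => [[z zZ [-> ->]]//|[/eqP-> yZ]]; by exists y.
  apply/imsetP/andP => [[z zZ [-> ->]]//|[/eqP-> yZ]]; by exists x.
have PP x y : (x, y) \in P -> [/\ e x y, x \in D & y \in D].
  by rewrite inE /= => /and3P.
have sub : [set (f p.1, f p.2) | p in P :\: bad] \subset P'.
  apply/fintype.subsetP => q /imsetP[[x y]]; rewrite inE mem_bad => /andP[nb /PP].
  move=> [exy xD yD] ->; rewrite /=.
  rewrite /P' inE /induced /contract /= !in_setD1 /f.
  move: nb; rewrite negb_or !negb_and !inE !negb_or !negb_and.
  have xy : x != y by apply: contraTneq exy => ->; rewrite ie.
  have [xv|xv] := eqVneq x v; have [yv|yv] := eqVneq y v.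
  - by move: xy; rewrite xv yv eqxx.
  - subst x; rewrite /= => /andP[/andP[yu _] _].
    by rewrite eqxx exy uD yv yD (eq_sym u) yu uv /= orbT.
  - subst y; rewrite /= => /andP[xu _].
    by rewrite eqxx (se v x) exy uD xv xD xu uv /= !orbT.
  - by rewrite xy exy xv yv xD yD.
have inj : {in P :\: bad &, injective (fun p => (f p.1, f p.2))}.
  have Q x y : (x, y) \in P :\: bad -> [/\ e x y, x != y,
      (x = v -> (y != u) && ~~ e u y) & (y = v -> (x != u) && ~~ e u x)].
    rewrite inE mem_bad => /andP[nb /PP[exy xD yD]]; split=> //.
    - by apply: contraTneq exy => ->; rewrite ie.
    - move=> xv; move: nb; rewrite xv eqxx /= negb_or !inE yD /= -xv exy andbT.
      by rewrite negb_or => /andP[].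
    - move=> yv; move: nb; rewrite yv eqxx /= negb_or !inE xD /= -yv (se y x) exy andbT.
      by rewrite negb_or => /andP[_].
  move=> [x y] [x' y'] /Q[exy xy xv yv] /Q[exy' xy' xv' yv'] [].
  have F a b : f a = f b -> [\/ a = b, a = v /\ b = u | a = u /\ b = v].
    rewrite /f; have [->|_] := eqVneq a v; have [->|_] := eqVneq b v.
    - by constructor 1.
    - by move=> <-; constructor 2.
    - by move=> ->; constructor 3.
    - by move=> ->; constructor 1.
  move=> /F[xx|[xe xe']|[xe xe']] /F[yy|[ye ye']|[ye ye']].
  - by rewrite xx yy.
  - by case/andP: (yv ye) => _; rewrite -ye' xx se exy'.
  - by case/andP: (yv' ye') => _; rewrite -ye -xx se exy.
  - by case/andP: (xv xe) => _; rewrite -xe' yy exy'.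
  - by move: xy; rewrite xe ye eqxx.
  - by case/andP: (xv xe); rewrite ye eqxx.
  - by case/andP: (xv' xe') => _; rewrite -xe -yy exy.
  - by case/andP: (xv' xe'); rewrite ye' eqxx.
  - by move: xy'; rewrite xe' ye' eqxx.
have : #|P :\: bad| <= #|P'|.
  by rewrite -(card_in_imset inj); exact: subset_leq_card.
rewrite -(cardsID bad P) addnC => h.
by apply: leq_add h _; apply: leq_trans cb; apply: subset_leq_card; exact: subsetIr.
Qed.

Lemma joined1 e x : joined e [set x].
Proof. by move=> a b /set1P-> /set1P->; exact: connect0. Qed.

Lemma clique_minor_lift t e D u v : symmetric e -> u \in D -> v \in D -> e u v ->
  clique_minor t (contract e u v) (D :\ v) -> clique_minor t e D.
Proof.
move=> se uD vD euv [B [B1 B2]].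
pose B' i := if u \in B i then v |: B i else B i.
have vB i : i < t -> v \notin B i.
  move=> /B1[/fintype.subsetP sB _ _]; apply/negP => /sB; by rewrite !inE eqxx.
have BB' i x : x \in B i -> x \in B' i.
  by rewrite /B'; case: ifP => // _ xB; rewrite inE xB orbT.
have B'E i x : x \in B' i -> (x \in B i) || ((x == v) && (u \in B i)).
  by rewrite /B'; case: ifP => uB; rewrite ?inE ?andbT ?andbF ?orbF // orbC.
have vB' i : u \in B i -> v \in B' i by rewrite /B' => ->; rewrite setU11.
exists B'; split=> [i it|i j /andP[ij jt]].
  have [/fintype.subsetP sB nB jB] := B1 i it; split.
  - apply/fintype.subsetP => x /B'E/orP[/sB|/andP[/eqP-> _]//].
    by rewrite inE => /andP[].
  - by have /set0Pn[x xB] := nB; apply/set0Pn; exists x; exact: BB'.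
  have cs : connect_sym (induced e (B' i)).
    by apply: sym_connect_sym => x y; rewrite /induced se (andbC (x \in _)).
  have vu : u \in B i -> connect (induced e (B' i)) v u.
    move=> uB; apply: connect1; by rewrite /induced se euv vB' // BB'.
  have sub x y : x \in B i -> y \in B i -> connect (induced e (B' i)) x y.
    move=> xB yB; have := jB x y xB yB; apply: connect_sub => a b.
    rewrite {1}/induced => /and3P[/andP[ab H] aB bB].
    case/or3P: H => [eab|/andP[/eqP au evb]|/andP[/eqP bu eva]].
    - by apply: connect1; rewrite /induced eab !BB'.
    - subst a; rewrite cs; apply: connect_trans (_ : connect _ v u); last exact: vu.
      by apply: connect1; rewrite /induced se evb vB' // BB'.
    - subst b; apply: connect_trans (vu bB).
      by apply: connect1; rewrite /induced se eva vB' // BB'.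
  move=> x y /B'E/orP[xB|/andP[/eqP-> uB]] /B'E/orP[yB|/andP[/eqP-> uB']].
  - exact: sub.
  - by rewrite cs; apply: connect_trans (vu uB') _; exact: sub.
  - by apply: connect_trans (vu uB) _; exact: sub.
  - exact: connect0.
have [dj [x [y [xB yB exy]]]] := B2 i j (introT andP (conj ij jt)).
have it := ltn_trans ij jt.
split=> [z /B'E/orP[zB|/andP[/eqP-> uB]]|].
- apply/negP => /B'E/orP[|/andP[/eqP zv _]]; first exact/negP/dj.
  by move: (vB _ it); rewrite -zv zB.
- by apply/negP => /B'E; rewrite (negPf (vB _ jt)) /= eqxx (negPf (dj _ uB)).
case/andP: exy => xy /or3P[exy|/andP[/eqP xu evy]|/andP[/eqP yu evx]].
- by exists x, y; split; [exact: BB'|exact: BB'|].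
- by subst x; exists v, y; split; [exact: vB'|exact: BB'|].
- by subst y; exists x, v; split; [exact: BB'|exact: vB'|rewrite se].
Qed.

Lemma clique_minor_cone t e D v : symmetric e -> irreflexive e -> v \in D ->
  clique_minor t e [set x in D | e v x] -> clique_minor t.+1 e D.
Proof.
move=> se ie vD [B [B1 B2]].
have BN i x : i < t -> x \in B i -> x \in D /\ e v x.
  by move=> /B1[/fintype.subsetP sB _ _] /sB; rewrite inE => /andP[].
exists (fun i => if i == t then [set v] else B i); split=> [i|i j /andP[ij]].
  rewrite ltnS leq_eqVlt; case: eqVneq => [_ _|_ /= it].
    split; [by rewrite sub1set|by apply/set0Pn; exists v; rewrite inE|].
    exact: joined1.
  have [_ ? ?] := B1 i it; split=> //.
  by apply/fintype.subsetP => x /(BN _ _ it)[].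
rewrite ltnS leq_eqVlt => /orP[/eqP jt|jt].
  subst j; rewrite eqxx (ltn_eqF ij); split.
    move=> x /(BN _ _ ij)[_ evx]; rewrite inE.
    by apply: contraTneq evx => ->; rewrite ie.
  have [_ /set0Pn[x xB] _] := B1 _ ij; exists x, v; split=> //.
    by rewrite inE.
  by rewrite se; case: (BN _ _ ij xB).
by rewrite (ltn_eqF jt) (ltn_eqF (ltn_trans ij jt)); apply: B2; rewrite ij.
Qed.

Lemma card_pairs (Q : rel T) :
  #|[set p : T * T | Q p.1 p.2]| = \sum_x #|[set y | Q x y]|.
Proof.
rewrite -sum1dep_card -(pair_big_dep xpredT Q (fun _ _ => 1)) /=.
by apply: eq_bigr => x _; rewrite sum1dep_card.
Qed.

Lemma deg_sum_ge e D A c : A \subset D ->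
  (forall x, x \in A -> c <= #|[set y in D | e x y]|) -> c * #|A| <= deg_sum e D.
Proof.
move=> /fintype.subsetP AD H; rewrite /deg_sum card_pairs mulnC -sum_nat_const.
rewrite [leqRHS](bigID (mem A)) /=.
apply: leq_trans (leq_addr _ _); apply: leq_sum => x xA.
apply: leq_trans (H x xA) _; apply: subset_leq_card; apply/fintype.subsetP => y.
by rewrite !inE /induced (AD x xA) => /andP[-> ->].
Qed.

(* Mader's argument: either some edge lies in few triangles and is contracted,
   or the neighborhood of a vertex is dense enough to contain a smaller minor. *)
Lemma dense_clique_minor t e D : symmetric e -> irreflexive e -> D != set0 ->
  minor_density t * #|D| <= deg_sum e D -> clique_minor t e D.
Proof.
move=> + + + +; elim: t => [|t IHt] in e D *.
  by move=> *; exists (fun _ => set0); split=> // i j; rewrite ltn0 andbF.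
have [n] := ubnP #|D|; elim: n => // n IHn in e D *.
rewrite ltnS => Dn se ie D0 dens.
case: (pselect (exists u v, [/\ u \in D, v \in D, e u v &
    #|[set y in D | e u y && e v y]| <= minor_density t])).
  move=> [u [v [uD vD euv cod]]].
  have uv : u != v by apply: contraTneq euv => ->; rewrite ie.
  have cD : #|D| = #|D :\ v|.+1 by rewrite (cardsD1 v D) vD.
  apply: (clique_minor_lift se uD vD euv); apply: IHn.
  - by rewrite -ltnS -cD.
  - exact: contract_sym.
  - by move=> x; rewrite /contract /= eqxx.
  - by apply/set0Pn; exists u; rewrite !inE uv.
  have := deg_sum_contract se ie uD vD euv.
  by move: dens; rewrite cD /=; set X := deg_sum _ _; set Y := deg_sum _ _; nia.
move=> N.
have /card_gt0P[[v w]] : 0 < deg_sum e D.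
  apply: leq_trans dens; rewrite muln_gt0 card_gt0 D0 andbT /=; lia.
rewrite inE /= => /and3P[evw vD wD].
apply: (clique_minor_cone se ie vD); apply: IHt => //.
  by apply/set0Pn; exists w; rewrite inE wD.
apply: deg_sum_ge => // x; rewrite inE => /andP[xD evx].
rewrite leqNgt; apply/negP => h; apply: N; exists v, x; split=> //.
apply: leq_trans (ltnW h).
rewrite -(@eq_card _ [set y in [set y in D | e v y] | e x y]) //.
by move=> y; rewrite !inE andbA.
Qed.
End CliqueMinors.

(** * Systems of disjoint short paths *)

Lemma card_bigcup_le (I T : finType) (S : {set I}) (A : I -> {set T}) m :
  (forall i, i \in S -> #|A i| <= m) -> #|\bigcup_(i in S) A i| <= m * #|S|.
Proof.
move=> H; rewrite mulnC -sum_nat_const.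
apply: (@leq_trans (\sum_(i in S) #|A i|)); last exact: leq_sum.
elim/big_rec2: _ => [|i B n _ h]; first by rewrite cards0.
by rewrite (leq_trans (leq_card_setU _ _)) // leq_add2l.
Qed.

(** A maximal independent set dominates [S], and each of its members dominates at most [m.+1]
    elements. *)
Lemma large_independent_subset (T : finType) (X : rel T) (S : {set T}) m :
  symmetric X -> (forall x, x \in S -> #|[set y in S | X x y]| <= m) ->
  exists I : {set T}, [/\ I \subset S, #|S| <= m.+1 * #|I| &
    {in I &, forall x y, x != y -> ~~ X x y}].
Proof.
move=> sX H.
pose P (I : {set T}) := (I \subset S) &&
  [forall x in I, forall y in I, (x != y) ==> ~~ X x y].
have P0 : P set0.
  by rewrite /P sub0set; apply/forall_inP => x; rewrite inE.
have [I /maxsetP[/andP[IS /forall_inP ind] maxI] _] := maxset_exists P0.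
have {}ind : {in I &, forall x y, x != y -> ~~ X x y}.
  by move=> x y xI yI; apply/implyP/(forall_inP (ind x xI)).
exists I; split=> //.
apply: leq_trans (card_bigcup_le (A := fun x => x |: [set y in S | X x y]) _).
  apply: subset_leq_card; apply/fintype.subsetP => y yS.
  apply/bigcupP; case: (boolP (y \in I)) => yI; first by exists y; rewrite ?setU11.
  have [/existsP[x /andP[xI xy]]|N] := boolP [exists x in I, X x y].
    by exists x; rewrite // !inE yS xy orbT.
  have Nx x : x \in I -> ~~ X x y
    by move=> xI; apply: contra N => xy; apply/existsP; exists x; rewrite xI.
  suff e : y |: I = I by move: yI; rewrite -e setU11.
  apply: maxI; last exact: subsetUr.
  apply/andP; split; first by rewrite subUset sub1set yS.
  apply/forall_inP => a aI; apply/forall_inP => b bI; apply/implyP => ab.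
  move: aI bI => /setU1P[ay|aI] /setU1P[by_|bI].
  - by move: ab; rewrite ay by_ eqxx.
  - by rewrite ay sX Nx.
  - by rewrite by_ Nx.
  - exact: ind.
move=> x xI; rewrite cardsU1 -[m.+1]add1n leq_add ?leq_b1 // H //.
exact: (fintype.subsetP IS).
Qed.

Section Linkages.
Variables (V : finType) (e : rel V).
Implicit Types (M Q : {set V}) (f g : V * V * {set V}) (F : {set V * V * {set V}}).

(** Repeated vertices are allowed, so that links can be spliced by concatenation; [short_link]
    recovers a path of bounded length. *)
Definition link a b Q : Prop := exists p, path e a (rcons p b) /\ p =i Q.

Definition ends f := [set f.1.1; f.1.2].

(* A triple [(a, b, Q)] stands for a path from [a] to [b] whose set of inner
   vertices is [Q]. *)
Record linkage L M F : Prop := Linkage {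
  linkage_ends : forall f, f \in F -> [/\ f.1.1 \in M, f.1.2 \in M & f.1.1 != f.1.2];
  linkage_size : forall f, f \in F -> #|f.2| <= L;
  linkage_link : forall f, f \in F -> link f.1.1 f.1.2 f.2;
  linkage_inner : forall f x, f \in F -> x \in f.2 -> x \notin M;
  linkage_simple : {in F &, injective ends};
  linkage_disjoint : forall f g x, f \in F -> g \in F -> x \in f.2 -> x \in g.2 ->
    f = g }.

Definition linked F : rel V :=
  fun a b => (a != b) && [exists f in F, ends f == [set a; b]].

Lemma linked_sym F : symmetric (linked F).
Proof. by move=> a b; rewrite /linked eq_sym setUC. Qed.

Definition walk_edges x s : seq {set V} := pairmap (fun a b => [set a; b]) x s.

Lemma walk_edgesP x s A : path e x s -> A \in walk_edges x s ->
  exists a b, [/\ A = [set a; b], e a b, a \in belast x s & b \in s].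
Proof.
elim: s x => //= y s IH x /andP[xy ys]; rewrite inE => /orP[/eqP->|As].
  by exists x, y; rewrite !mem_head.
have [a [b [-> ab ai bi]]] := IH y ys As.
by exists a, b; split=> //; rewrite inE ?ai ?bi orbT.
Qed.

End Linkages.

(** * Linkages in a drawing have linearly many links *)

Section PlanarLinkage.
Import Order.TTheory GRing.Theory Num.Theory.
Local Open Scope nat_scope.
Variables (R : realFieldType) (V : finType) (e : rel V).
Variables (v : V -> R * R) (K : {set V} -> R * R -> Prop) (X : rel {set V}).
Variables (d : R) (E : {set {set V}}).
Hypothesis d0 : (0 < d)%R.
Hypothesis edgeE : forall x y, e x y -> [set x; y] \in E.
Hypothesis chainK : forall x y, [set x; y] \in E -> exists s,
  [/\ path (nearby d) (v x) s, last (v x) s = v y &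
      {in v x :: s, forall z, K [set x; y] z}].
Hypothesis farK : forall A B, A \in E -> B \in E ->
  (forall x, x \in A -> x \notin B) -> ~~ X A B ->
  forall z w, K A z -> K B w -> far (d *+ 2) z w.

(** The case [x = y] is separate because [D] need not contain [v x]: the region of a branch set that
    is a single vertex is empty. *)
Definition chained (D : R * R -> Prop) x y := x = y \/ exists s,
  [/\ path (nearby d) (v x) s, last (v x) s = v y & {in v x :: s, forall z, D z}].

Lemma chained_trans D x y z : chained D x y -> chained D y z -> chained D x z.
Proof.
move=> [->//|[s [ps ls sD]]] [<-|[t [pt lt tD]]]; first by right; exists s.
right; exists (s ++ t); rewrite cat_path last_cat ls ps pt; split=> // u.
rewrite -cat_cons mem_cat => /orP[/sD//|ut]; by apply: tD; rewrite inE ut orbT.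
Qed.

Lemma chained_sym D x y : chained D x y -> chained D y x.
Proof.
move=> [->|[s [ps ls sD]]]; [by left|right].
exists (rev (belast (v x) s)); rewrite -ls rev_path; split.
- by rewrite (@eq_path _ _ (nearby d)) // => z w; rewrite nearbyC.
- by case: s {ps ls sD} => //= z s; rewrite rev_cons last_rcons.
- move=> z; rewrite inE mem_rev => zi; apply: sD.
  by case/orP: zi => [/eqP->|/mem_belast//]; exact: mem_last.
Qed.

Lemma chained_mono (D D' : R * R -> Prop) x y : (forall z, D z -> D' z) ->
  chained D x y -> chained D' x y.
Proof.
move=> DD [->|[s [ps ls sD]]]; [by left|right; exists s; split=> // z zi].
exact/DD/sD.
Qed.

Lemma chained_walk x s : path e x s ->
  chained (fun z => exists2 A, A \in walk_edges x s & K A z) x (last x s).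
Proof.
elim: s x => [|y s IH] x /=; first by left.
move=> /andP[xy ys]; apply: (@chained_trans _ _ y).
  right; have [t [pt lt tK]] := chainK (edgeE xy).
  by exists t; split=> // z /tK Kz; exists [set x; y]; rewrite ?mem_head.
apply: chained_mono (IH y ys) => z [A As Az].
by exists A; rewrite // inE As orbT.
Qed.

Section NoncrossingLinkage.
Variables (L : nat) (M : {set V}) (F : {set V * V * {set V}}).
Variable W : V * V * {set V} -> seq {set V}.
Hypothesis linkF : linkage e L M F.
Hypothesis chainW : forall f, f \in F ->
  chained (fun z => exists2 A, A \in W f & K A z) f.1.1 f.1.2.
Hypothesis WE : forall f A, f \in F -> A \in W f -> A \in E.
Hypothesis Wsub : forall f A x, f \in F -> A \in W f -> x \in A ->
  x \in ends f :|: f.2.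
Hypothesis noncross : {in F &, forall f g, f != g ->
  forall A B, A \in W f -> B \in W g -> ~~ X A B}.

Lemma card_linkage_deg : #|F| <= deg_sum (linked F) M.
Proof.
have inj : {in F &, injective (fun f => f.1)}.
  move=> f g fF gF fg; apply: (linkage_simple linkF fF gF).
  by rewrite /ends fg.
rewrite -(card_in_imset inj); apply/subset_leq_card/fintype.subsetP => p.
move=> /imsetP[f fF ->]; rewrite inE /induced /linked.
have [-> -> ->] := linkage_ends linkF fF; rewrite /= andbT.
by apply/existsP; exists f; rewrite fF eqxx.
Qed.

Definition region (S : {set V}) z := exists2 f, (f \in F) && (ends f \subset S) &
  exists2 A, A \in W f & K A z.

(** Links with ends in disjoint sets are distinct and share no vertex, since inner vertices avoid
    [M] and belong to one link only. Their edges are thus disjoint and noncrossing, as [farK]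
    requires. *)
Lemma region_far (S S' : {set V}) z w : (forall x, x \in S -> x \notin S') ->
  region S z -> region S' w -> far (d *+ 2) z w.
Proof.
move=> SS' [f /andP[fF /fintype.subsetP fS] [A Af Az]].
move=> [g /andP[gF /fintype.subsetP gS] [B Bg Bw]].
have e1 (h : V * V * {set V}) : h.1.1 \in ends h by rewrite !inE eqxx.
have fg : f != g.
  by apply/eqP => fg; move: (SS' _ (fS _ (e1 f))); rewrite fg gS.
have eM h x : h \in F -> x \in ends h -> x \in M.
  by move=> /(linkage_ends linkF)[? ? _]; rewrite !inE => /orP[]/eqP->.
apply: (farK (WE fF Af) (WE gF Bg) _ (noncross fF gF fg Af Bg) Az Bw).
move=> x xA; apply/negP => xB.
case/setUP: (Wsub fF Af xA) => xf; case/setUP: (Wsub gF Bg xB) => xg.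
- by move: (SS' _ (fS _ xf)); rewrite gS.
- by have := linkage_inner linkF gF xg; rewrite (eM _ _ fF).
- by have := linkage_inner linkF fF xf; rewrite (eM _ _ gF).
- by move/eqP: fg; apply; exact: (linkage_disjoint linkF fF gF xf xg).
Qed.

Lemma chained_region (S : {set V}) x y : connect (induced (linked F) S) x y ->
  chained (region S) x y.
Proof.
move=> /connectP[s ps ->]; elim: s x ps => [|z s IH] x /=; first by left.
move=> /andP[/and3P[/andP[xz /exists_inP[f fF /eqP fe]] xS zS] /IH].
apply: chained_trans.
have H : chained (region S) f.1.1 f.1.2.
  apply: chained_mono (chainW fF) => w Aw; exists f => //.
  by rewrite fF fe subUset !sub1set xS.
have [_ _ ne] := linkage_ends linkF fF.
have : x \in ends f by rewrite fe !inE eqxx.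
have : z \in ends f by rewrite fe !inE eqxx orbT.
rewrite !inE => /orP[]/eqP-> /orP[]/eqP ->.
- by left.
- exact: chained_sym.
- exact: H.
- by left.
Qed.

Lemma linked_no_K6 : ~ clique_minor 6 (linked F) M.
Proof.
move=> [B [B1 B2]].
have [x0 _] : exists x, x \in B 0 by have [_ /set0Pn] := B1 0 isT.
pose r i := odflt x0 [pick x in B i].
have rB i : i < 6 -> r i \in B i.
  move=> /B1[_ /set0Pn[x xB] _]; rewrite /r; case: pickP => //= /(_ x).
  by rewrite xB.
have disj i j x : i < 6 -> j < 6 -> i != j -> x \in B i -> x \notin B j.
  move=> i6 j6; rewrite neq_ltn => /orP[ij|ji] xi.
    by have [+ _] := B2 i j (introT andP (conj ij j6)); apply.
  apply/negP => xj; have [+ _] := B2 j i (introT andP (conj ji i6)).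
  by move=> /(_ x xj); rewrite xi.
have within i (S : {set V}) x y : i < 6 -> B i \subset S -> x \in B i -> y \in B i ->
    chained (region S) x y.
  move=> i6 iS xi yi; have [_ _ jB] := B1 i i6.
  apply: chained_mono (chained_region (jB x y xi yi)).
  move=> z [f /andP[fF fB] H]; exists f => //.
  by rewrite fF (subset_trans fB iS).
(* Branch sets 0, 1, 2 and 3, 4, 5 are the sides of K_{3,3}. The chain for [(i, j)] stays in the
   region of two branch sets, so independent edges use disjoint vertex sets. *)
have rr (i j : 'I_3) : exists s, [/\ path (nearby d) (v (r i)) s,
    last (v (r i)) s = v (r (3 + j)) &
    {in v (r i) :: s, forall z, region (B i :|: B (3 + j)) z}].
  have i6 : i < 6 by apply: ltn_trans (ltn_ord i) _.
  have j6 : 3 + j < 6 by rewrite -[6]/(3 + 3) ltn_add2l.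
  have ij : i < 3 + j by rewrite ltn_addr.
  have [_ [x [y [xi yj xy]]]] := B2 i (3 + j) (introT andP (conj ij j6)).
  have : chained (region (B i :|: B (3 + j))) (r i) (r (3 + j)).
    apply: chained_trans (within i _ _ x i6 (subsetUl _ _) (rB i i6) xi) _.
    apply: chained_trans (within _ _ y _ j6 (subsetUr _ _) yj (rB _ j6)).
    apply/chained_region/connect1.
    by rewrite /induced xy !in_setU xi yj orbT.
  case=> // rij; have := disj i _ (r i) i6 j6 (negbT (ltn_eqF ij)) (rB i i6).
  by rewrite rij rB.
have [t tP] := choice (fun p : 'I_3 * 'I_3 => rr p.1 p.2).
apply: (@no_fine_K33 _ d (fun i => v (r i)) (fun j => v (r (3 + j)))
  (fun i j => t (i, j))) => // [i j|i j i' j' ii jj].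
  by have [] := tP (i, j).
have [_ _ H] := tP (i, j); have [_ _ H'] := tP (i', j').
move=> z w /H rz /H' rw; apply: region_far rz rw => x /= xS.
have l6 (k : 'I_3) : k < 6 by apply: ltn_trans (ltn_ord k) _.
have r6 (k : 'I_3) : 3 + k < 6 by rewrite -[6]/(3 + 3) ltn_add2l.
have lr (k l : 'I_3) : k != 3 + l :> nat by rewrite ltn_eqF // ltn_addr.
rewrite in_setU negb_or; case/setUP: xS => xS; apply/andP; split.
- exact: disj xS.
- by apply: disj xS.
- by apply: disj xS; rewrite // eq_sym.
- by apply: disj xS; rewrite // eqn_add2l.
Qed.

Lemma noncrossing_linkage_card : #|F| <= minor_density 6 * #|M|.
Proof.
have [M0|M0] := eqVneq M set0.
  rewrite M0 cards0 muln0 leqNgt; apply/negP => /card_gt0P[f /(linkage_ends linkF)].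
  by rewrite M0 inE => -[].
rewrite leqNgt; apply/negP => /ltnW h; apply: linked_no_K6.
apply: dense_clique_minor => //; first exact: linked_sym.
  by move=> x; rewrite /linked eqxx.
exact: leq_trans h card_linkage_deg.
Qed.

End NoncrossingLinkage.
Lemma short_link L a b (Q : {set V}) : a != b -> #|Q| <= L -> link e a b Q ->
  exists p, [/\ path e a (rcons p b), {subset p <= Q} & size p <= L].
Proof.
move=> ab QL [p [pp pQ]]; move: (last_rcons a p b).
case/shortenP: pp => p'; case: (lastP p') => [_ _ _ /= e1|p'' z pp' up' sp'].
  by move: ab; rewrite e1 eqxx.
rewrite last_rcons => zb; subst z.
have sQ : {subset p'' <= Q}.
  move=> x xp; rewrite -pQ; have := sp' x; rewrite mem_rcons inE xp orbT => /(_ isT).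
  rewrite mem_rcons inE => /orP[/eqP xb|//].
  by move: up'; rewrite /= rcons_uniq -xb xp andbF.
exists p''; split=> //; apply: leq_trans QL; rewrite cardE.
apply: uniq_leq_size => [|x /sQ]; last by rewrite mem_enum.
by move: up'; rewrite /= rcons_uniq => /and3P[].
Qed.

(** A link has at most [L.+1] edges, each crosses at most [k] edges, and each of those lies on at
    most one link. So a link conflicts with at most [k * L.+1] links, and a noncrossing subfamily
    retains a fixed proportion. *)
Lemma linkage_card k L M F : symmetric X ->
  (forall A, A \in E -> #|[set B in E | X A B]| <= k) ->
  linkage e L M F -> #|F| <= (k * L.+1).+1 * (minor_density 6 * #|M|).
Proof.
move=> sX Xk lF.
have /choice[pth pthP] (f : V * V * {set V}) : exists p, f \in F ->
    [/\ path e f.1.1 (rcons p f.1.2), {subset p <= f.2} & size p <= L].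
  have [fF|fF] := boolP (f \in F); last by exists [::].
  have [_ _ ne] := linkage_ends lF fF.
  by have [p ?] := short_link ne (linkage_size lF fF) (linkage_link lF fF); exists p.
pose W f := walk_edges f.1.1 (rcons (pth f) f.1.2).
have WP f A : f \in F -> A \in W f ->
    [/\ A \in E, A \subset ends f :|: f.2 &
        A = ends f \/ exists2 x, x \in A & x \in f.2].
  move=> fF AW; have [pf pQ _] := pthP f fF.
  have [x [y [-> xy]]] := walk_edgesP pf AW.
  rewrite belast_rcons mem_rcons => xi yi; split.
  - exact: edgeE.
  - rewrite subUset !sub1set !inE; apply/andP; split.
      by case/predU1P: xi => [->|/pQ ->]; rewrite ?eqxx ?orbT.
    by case/predU1P: yi => [->|/pQ ->]; rewrite ?eqxx ?orbT.
  - case/predU1P: xi => [->|/pQ xQ]; last first.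
      by right; exists x => //; rewrite !inE eqxx.
    case/predU1P: yi => [->|/pQ yQ]; first by left.
    by right; exists y => //; rewrite !inE eqxx orbT.
have endM f x : f \in F -> x \in ends f -> x \in M.
  by move=> /(linkage_ends lF)[? ? _]; rewrite !inE => /orP[]/eqP->.
(* An edge of a link either has an inner vertex, which determines the link, or joins its two ends,
   which also determine it. *)
have Wdisj f g A : f \in F -> g \in F -> A \in W f -> A \in W g -> f = g.
  move=> fF gF Af Ag.
  have [_ /fintype.subsetP sf Hf] := WP f A fF Af.
  have [_ /fintype.subsetP sg Hg] := WP g A gF Ag.
  case: Hf => [ef|[x xA xf]].
    case: Hg => [eg|[x xA xg]]; first by apply: (linkage_simple lF) => //; rewrite -ef.
    have := linkage_inner lF gF xg; rewrite (endM f) //.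
    by rewrite -ef.
  case/setUP: (sg x xA) => [xg|xg]; last exact: (linkage_disjoint lF fF gF xf xg).
  by have := linkage_inner lF fF xf; rewrite (endM g).
pose conflict f g := [exists A in [set A in W f], exists B in [set B in W g], X A B].
have sc : symmetric conflict.
  move=> f g; apply/exists_inP/exists_inP => -[A Af /exists_inP[B Bg AB]];
  by exists B => //; apply/exists_inP; exists A; rewrite // sX.
have cW f : f \in F -> #|[set A in W f]| <= L.+1.
  move=> /pthP[_ _ sp]; rewrite cardsE (leq_trans (card_size _)) //.
  by rewrite /W /walk_edges size_pairmap size_rcons.
have [|F' [F'F cF' ind]] := @large_independent_subset _ conflict F (k * L.+1) sc.
  move=> f fF.
  apply: (@leq_trans #|\bigcup_(A in [set A in W f])
      \bigcup_(B in [set B in E | X A B]) [set g in F | B \in W g]|).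
    apply/subset_leq_card/fintype.subsetP => g; rewrite inE => /andP[gF].
    move=> /exists_inP[A Af /exists_inP[B Bg AB]]; apply/bigcupP; exists A => //.
    rewrite inE in Bg; have [BE _ _] := WP g B gF Bg.
    by apply/bigcupP; exists B; rewrite inE ?gF ?BE.
  apply: leq_trans (leq_mul (leqnn k) (cW f fF)); apply: card_bigcup_le => A.
  rewrite inE => /(WP f A fF)[AE _ _].
  rewrite -[k]mul1n; apply: leq_trans (leq_mul (leqnn 1) (Xk A AE)).
  apply: card_bigcup_le => B _; apply/card_le1_eqP => g h.
  by rewrite !inE => /andP[gF Bg] /andP[hF Bh]; exact: Wdisj hF gF Bh Bg.
apply: leq_trans cF' _; rewrite leq_mul2l /=.
have {}F'F f : f \in F' -> f \in F by exact: (fintype.subsetP F'F).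
apply: (@noncrossing_linkage_card L M F' W).
- split.
  + by move=> f /F'F; exact: (linkage_ends lF).
  + by move=> f /F'F; exact: (linkage_size lF).
  + by move=> f /F'F; exact: (linkage_link lF).
  + by move=> f x /F'F; exact: (linkage_inner lF).
  + by move=> f g /F'F fF /F'F gF; exact: (linkage_simple lF).
  + by move=> f g x /F'F fF /F'F gF; exact: (linkage_disjoint lF).
- move=> f /F'F fF; have [pf _ _] := pthP f fF.
  by have := chained_walk pf; rewrite last_rcons.
- by move=> f A /F'F fF /(WP f A fF)[].
- by move=> f A x /F'F fF /(WP f A fF)[_ /fintype.subsetP sA _] /sA.
- move=> f g fF gF fg A B Af Bg; apply: contra (ind f g fF gF fg) => AB.
  apply/exists_inP; exists A; rewrite ?inE //.
  by apply/exists_inP; exists B; rewrite ?inE.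
Qed.

End PlanarLinkage.

(** * Separators and weak reachability *)

Lemma split_has (T : eqType) (a : pred T) (s : seq T) : has a s ->
  exists s1 x s2, [/\ s = s1 ++ x :: s2, a x & ~~ has a s1].
Proof.
elim: s => //= y s IH; have [ay _|nay /= /IH[s1 [x [s2 [-> ax n1]]]]] := boolP (a y).
  by exists [::], y, s.
by exists (y :: s1), x, s2; rewrite /= negb_or nay.
Qed.

Section Separators.
Variables (V : finType) (e : rel V).
Hypothesis se : symmetric e.
Implicit Types (M Q S I : {set V}) (f g : V * V * {set V}) (F : {set V * V * {set V}}).

Lemma linkage_weak L L' M F : L <= L' -> linkage e L M F -> linkage e L' M F.
Proof.
move=> LL []; split=> // f fF; apply: leq_trans LL; auto.
Qed.

Definition admissible L M f := [/\ [/\ f.1.1 \in M, f.1.2 \in M & f.1.1 != f.1.2],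
  #|f.2| <= L, link e f.1.1 f.1.2 f.2 & forall x, x \in f.2 -> x \notin M].

Lemma linkageU1 L M F f : linkage e L M F -> admissible L M f ->
  (forall g, g \in F -> ends g != ends f) ->
  (forall g x, g \in F -> x \in g.2 -> x \notin f.2) -> linkage e L M (f |: F).
Proof.
move=> [l1 l2 l3 l4 l5 l6] [a1 a2 a3 a4] ne dj; split.
- by move=> g /setU1P[->|/l1].
- by move=> g /setU1P[->|/l2].
- by move=> g /setU1P[->|/l3].
- by move=> g x /setU1P[->|gF]; [exact: a4|exact: l4].
- move=> g h /setU1P[->|gF] /setU1P[->|hF] // E.
  + by move: (ne h hF); rewrite E eqxx.
  + by move: (ne g gF); rewrite E eqxx.
  + exact: l5.
- move=> g h x /setU1P[->|gF] /setU1P[->|hF] // xg xh.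
  + by move: (dj h x hF xh); rewrite xg.
  + by move: (dj g x gF xg); rewrite xh.
  + exact: l6 xg xh.
Qed.

Lemma maximal_linkage L M I : exists F, [/\ linkage e L M F,
  forall f, f \in F -> f.1.1 \in I &
  forall f, admissible L M f -> f.1.1 \in I ->
    exists2 g, g \in F & ends g = ends f \/ exists2 x, x \in g.2 & x \in f.2].
Proof.
pose P F := `[< linkage e L M F /\ forall f, f \in F -> f.1.1 \in I >].
have P0 : P set0.
  by apply/asboolP; split=> [|f]; rewrite ?inE //; split=> f; rewrite inE.
have [F /maxsetP[/asboolP[lF FI] maxF] _] := maxset_exists P0.
exists F; split=> // f af fI; apply: contrapT => N.
have ne g : g \in F -> ends g != ends f.
  by move=> gF; apply/eqP => E; apply: N; exists g => //; left.
have dj g x : g \in F -> x \in g.2 -> x \notin f.2.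
  by move=> gF xg; apply/negP => xf; apply: N; exists g => //; right; exists x.
have e1 : f |: F = F.
  apply: maxF; last exact: subsetUr.
  by apply/asboolP; split; [exact: linkageU1|move=> g /setU1P[->|/FI]].
by have := ne f; rewrite -e1 setU11 eqxx => /(_ isT).
Qed.

(** The second link is followed backwards from [x], so that the new link joins the two starting
    points; for the links of [F2] below these lie in [I]. *)
Lemma link_splice a b a' b' Q Q' x : link e a b Q -> link e a' b' Q' ->
  x \in Q -> x \in Q' -> exists2 Q0, link e a a' Q0 & Q0 \subset Q :|: Q'.
Proof.
move=> [p [pp pQ]] [q [qq qQ]]; rewrite -pQ -qQ => /splitPr xp /splitPr xq.
case: xp pp pQ => p1 p2 pp pQ; case: xq qq qQ => q1 q2 qq qQ.
exists [set y in p1 ++ x :: rev q1].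
  exists (p1 ++ x :: rev q1); split; last by move=> y; rewrite inE.
  move: pp qq; rewrite !rcons_cat !rcons_cons -!cat_rcons !cat_path.
  rewrite rcons_path last_rcons => /andP[-> _] /andP[]; rewrite rcons_path.
  move=> qx _; rewrite /= .
  have : path e x (rev (a' :: q1)).
    move: qx; rewrite -rcons_path -rev_path last_rcons belast_rcons.
    by rewrite (@eq_path _ _ e) // => y z; rewrite se.
  by rewrite rev_cons.
apply/fintype.subsetP => y; rewrite inE mem_cat inE mem_rev in_setU -pQ -qQ.
by rewrite !mem_cat !inE => /or3P[->|->|->]; rewrite ?orbT.
Qed.

Variables (c r : nat).
Hypothesis sparse : forall M F, linkage e (2 * r) M F -> #|F| <= c * #|M|.

(** A link of [F2] has at most [r + 2] vertices and is counted at no more than 2 vertices of [I].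
    The rest comes from [#|F2| <= c * #|M|], [#|M| <= (1 + 2 * r * c) * #|S|] and
    [#|S| <= 2 * (4 * c + 1) * #|I|]. *)
Definition sep_size := 4 * (r + 2) * c * (1 + 2 * r * c) * (4 * c + 1).

(* [F1] is a maximal linkage on [S], and [F2] a maximal linkage from an
   independent set [I] of the graph of [F1] to the vertices of [S] and [F1]. The
   links of [F2] at [v] separate [v]: a path avoiding them would run into a link
   of [F2] at another vertex of [I], and so extend [F1]. As [F2] is sparse, some
   [v] has few links. *)
Lemma exists_separated S : S != set0 -> exists v (X : {set V}),
  [/\ v \in S, #|X| <= sep_size &
    forall p s, path e v (rcons p s) -> s \in S -> s != v ->
      (forall x, x \in p -> x \notin S) -> size p < r -> has (mem X) (rcons p s)].
Proof.
move=> S0; have s0 : 0 < #|S| by rewrite card_gt0.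
have [F1 [l1 _ max1]] := maximal_linkage (2 * r) S setT.
pose M := S :|: \bigcup_(f in F1) f.2.
have cF1 := sparse l1.
have cM : #|M| <= (1 + 2 * r * c) * #|S|.
  apply: leq_trans (leq_card_setU _ _) _; rewrite mulnDl mul1n leq_add2l -mulnA.
  apply: leq_trans (card_bigcup_le (m := 2 * r) _) _; last first.
    by rewrite leq_mul2l cF1 orbT.
  by move=> f /(linkage_size l1).
pose deg x := #|[set y in S | linked F1 x y]|.
(* The degrees sum to at most [2 * c * #|S|], so at least half of [S] is low. *)
pose low := [set x in S | deg x <= 4 * c].
have clow : #|S| <= 2 * #|low|.
  have : deg_sum (linked F1) S <= 2 * #|F1|.
    have sub : [set p : V * V | induced (linked F1) S p.1 p.2] \subset
        [set f.1 | f in F1] :|: [set (f.1.2, f.1.1) | f in F1].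
      apply/fintype.subsetP => -[a b].
      rewrite inE => /and3P[/andP[ab /exists_inP[f fF /eqP E]] _ _].
      have : a \in ends f by rewrite E !inE eqxx.
      have : b \in ends f by rewrite E !inE eqxx orbT.
      move: fF ab {E}; case: f => [[x y] Q] fF ab; rewrite !inE /=.
      move=> /orP[]/eqP eb /orP[]/eqP ea; subst a b.
      - by rewrite eqxx in ab.
      - by apply/orP; right; apply/imsetP; exists (x, y, Q).
      - by apply/orP; left; apply/imsetP; exists (x, y, Q).
      - by rewrite eqxx in ab.
    apply: leq_trans (subset_leq_card sub) _; apply: leq_trans (leq_card_setU _ _) _.
    by rewrite mul2n -addnn leq_add // leq_imset_card.
  have : (4 * c + 1) * #|S :\: low| <= deg_sum (linked F1) S.
    apply: deg_sum_ge; first exact: subsetDl.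
    move=> x; rewrite !inE negb_and => /andP[+ xS]; rewrite xS -ltnNge /=.
    by rewrite addn1.
  have : #|S| = #|low| + #|S :\: low|.
    rewrite -(cardsID low S); congr (_ + _); apply: eq_card => x.
    by rewrite !inE; case: (x \in S).
  by move: (deg_sum _ _) (#|S :\: low|) => X Y; nia.
have [|I [/fintype.subsetP Ilow cI ind]] :=
  @large_independent_subset _ (linked F1) low (4 * c) (@linked_sym _ F1).
  move=> x; rewrite inE => /andP[_]; apply: leq_trans; apply: subset_leq_card.
  by apply/fintype.subsetP => y; rewrite !inE => /andP[/andP[-> _] ->].
have IS x : x \in I -> x \in S by move=> /Ilow; rewrite inE => /andP[].
have [F2 [l2 F2I max2]] := maximal_linkage r M I.
have cF2 : #|F2| <= c * #|M|.
  by apply: sparse; apply: linkage_weak l2; rewrite mul2n -addnn leq_addr.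
pose F2_ v := [set f in F2 | v \in ends f].
pose X v := \bigcup_(f in F2_ v) (ends f :|: f.2).
have [v vI cX] : exists2 v, v \in I & #|X v| <= sep_size.
  apply: contrapT => N.
  have h1 : \sum_(v in I) sep_size.+1 <= \sum_(v in I) (r + 2) * #|F2_ v|.
    apply: leq_sum => v vI; apply: (@leq_trans #|X v|).
      by rewrite ltnNge; apply/negP => h; apply: N; exists v.
    apply: card_bigcup_le => f; rewrite inE => /andP[fF _].
    apply: leq_trans (leq_card_setU _ _) _; rewrite addnC leq_add //.
      exact: linkage_size l2 _ fF.
    by rewrite cards2; case: (_ == _).
  have h2 : \sum_(v in I) #|F2_ v| <= 2 * #|F2|.
    rewrite (eq_bigr (fun v => \sum_(f in F2) (v \in ends f))); last first.
      move=> v _; rewrite -sum1dep_card big_mkcondr /=.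
      by apply: eq_bigr => f _; case: (_ \in _).
    rewrite exchange_big mulnC -sum_nat_const; apply: leq_sum => f _.
    rewrite (@leq_trans #|ends f|) //; last by rewrite cards2; case: (_ == _).
    rewrite -sum1_card big_mkcond [leqRHS]big_mkcond; apply: leq_sum => x _.
    by case: (x \in I); case: (x \in ends f).
  rewrite sum_nat_const -big_distrr /= in h1.
  have I0 : 0 < #|I| by lia.
  have h3 : \sum_(v in I) #|F2_ v| <=
      2 * (c * ((1 + 2 * r * c) * (2 * ((4 * c).+1 * #|I|)))).
    apply: leq_trans h2 _; rewrite leq_mul2l /= (leq_trans cF2) // leq_mul2l.
    rewrite (leq_trans cM) ?orbT // leq_mul2l (leq_trans clow) ?orbT //.
    by rewrite leq_mul2l /=.
  have := leq_trans h1 (leq_mul (leqnn (r + 2)) h3).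
  suff -> : (r + 2) * (2 * (c * ((1 + 2 * r * c) * (2 * ((4 * c).+1 * #|I|))))) =
    #|I| * sep_size by rewrite leq_mul2l ltnn orbF eqn0Ngt I0.
  by rewrite /sep_size; lia.
exists v, (X v); split=> //; first exact: IS.
move=> p s pp sS sv pS szp; apply/negPn/negP => nX.
have SM x : x \in S -> x \in M by move=> xS; rewrite inE xS.
(* Cut the path at its first vertex [m] in [M]; one exists as [s] is in [S]. The part from [v] to
   [m] is a candidate link for [F2]. *)
have : has (mem M) (rcons p s) by rewrite has_rcons /= SM.
move=> /split_has[p1 [m [p2 [E mM /hasPn p1M]]]].
have sz1 : #|[set x in p1]| < r.
  apply: leq_ltn_trans szp; rewrite cardsE (leq_trans (card_size _)) //.
  by have := congr1 size E; rewrite size_rcons size_cat /=; lia.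
have nv x : x \in rcons p s -> x != v.
  rewrite mem_rcons inE => /predU1P[->//|/pS]; apply: contraNneq => ->; exact: IS.
have nXP x : x \in rcons p s -> x \notin X v by exact: (hasPn nX).
have mp : m \in rcons p s by rewrite E mem_cat mem_head orbT.
have p1p x : x \in p1 -> x \in rcons p s by rewrite E mem_cat => ->.
have l0 : link e v m [set x in p1].
  exists p1; split; last by move=> x; rewrite inE.
  by move: pp; rewrite E -cat_rcons cat_path => /andP[].
have XP f x : f \in F2 -> v \in ends f -> x \in ends f :|: f.2 -> x \in X v.
  by move=> fF vf xf; apply/bigcupP; exists f; rewrite // inE fF.
have [|g gF] := max2 (v, m, [set x in p1]) _ vI.
  split=> //=; last by move=> x; rewrite inE => /p1M.
    by split=> //; [exact/SM/IS|rewrite eq_sym nv].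
  exact: ltnW.
case=> [eg|[x xg /=]].
  have vg : v \in ends g by rewrite eg !inE eqxx.
  have mg : m \in ends g by rewrite eg !inE eqxx orbT.
  by have := nXP m mp; rewrite (XP g m gF vg) // inE mg.
rewrite inE => xp1.
have [vg|vg] := boolP (v \in ends g).
  by have := nXP x (p1p x xp1); rewrite (XP g x gF vg) // inE xg orbT.
(* Splicing gives a link between two vertices of [I] with at most [2 * r] inner vertices, none in
   [M]. It meets no link of [F1] inside, so maximality of [F1] forces its ends to be adjacent
   already. *)
have [Q lQ /fintype.subsetP sQ] :
    exists2 Q, link e v g.1.1 Q & Q \subset [set x in p1] :|: g.2.
  by apply: link_splice l0 (linkage_link l2 gF) _ xg; rewrite inE.
have QM y : y \in Q -> y \notin M.
  by move=> /sQ/setUP[|/(linkage_inner l2 gF)//]; rewrite inE => /p1M.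
have vg' : v != g.1.1 by apply: contraNneq vg => ->; rewrite !inE eqxx.
have gI := F2I g gF.
have [|h hF] := max1 (v, g.1.1, Q) _ (in_setT _).
  split=> //=; last by move=> y /QM; apply: contra; exact: SM.
    by split=> //; exact: IS.
  apply: leq_trans (subset_leq_card (introT fintype.subsetP sQ)) _.
  apply: leq_trans (leq_card_setU _ _) _; rewrite mul2n -addnn leq_add ?(ltnW sz1) //.
  exact: linkage_size l2 _ gF.
case=> [eh|[y yh /= /QM]]; last first.
  by rewrite inE negb_or => /andP[_ /negP]; apply; apply/bigcupP; exists h.
have := ind v g.1.1 vI gI vg'; rewrite /linked vg' => /negP; apply.
by apply/exists_inP; exists h => //; apply/eqP.
Qed.
End Separators.

Lemma greedy_coloring (T : finType) (sigma : T -> nat) (N : T -> {set T}) b :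
  injective sigma -> (forall v, #|N v| <= b) ->
  exists phi : T -> 'I_b.+1,
    forall u v, u \in N v -> sigma u < sigma v -> phi u != phi v.
Proof.
move=> si Nb; suff H n : exists phi : T -> 'I_b.+1, forall u v, sigma v < n ->
    u \in N v -> sigma u < sigma v -> phi u != phi v.
  have [phi phiP] := H (\max_v sigma v).+1; exists phi => u v.
  by apply: phiP; rewrite ltnS leq_bigmax.
elim: n => [|n [phi phiP]]; first by exists (fun _ => ord0).
have [[v0 v0n]|none] := pselect (exists v0, sigma v0 = n); last first.
  exists phi => u v; rewrite ltnS leq_eqVlt => /predU1P[vn|]; last exact: phiP.
  by case: none; exists v.
have /fintype.subsetPn[c _ cN] : ~~ ([set: 'I_b.+1] \subset phi @: N v0).
  apply/negP => /subset_leq_card; rewrite cardsT card_ord leqNgt ltnS.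
  by rewrite (leq_trans (leq_imset_card _ _)).
exists (fun v => if v == v0 then c else phi v) => u v vn uN uv.
have [e1|nv] := eqVneq v v0.
  subst v; have -> : (u == v0) = false by apply: contraTF uv => /eqP->; rewrite ltnn.
  by apply: contraNneq cN => <-; exact: imset_f.
have {}vn : sigma v < n.
  move: vn; rewrite ltnS leq_eqVlt -v0n => /predU1P[/si vv|//].
  by rewrite vv eqxx in nv.
rewrite (_ : (u == v0) = false); first exact: phiP.
by apply: contraTF vn => /eqP uv0; rewrite -leqNgt -v0n -uv0 ltnW.
Qed.

(** * Weak coloring numbers from separators *)

Section WeakReachability.
Variables (V : finType) (e : rel V) (q r : nat).
Hypothesis separated : forall S : {set V}, S != set0 -> exists v (X : {set V}),
  [/\ v \in S, #|X| <= q &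
    forall p s, path e v (rcons p s) -> s \in S -> s != v ->
      (forall x, x \in p -> x \notin S) -> size p < r -> has (mem X) (rcons p s)].

Lemma separator_order : exists (sigma : V -> nat) (X : V -> {set V}),
  injective sigma /\ forall v, #|X v| <= q /\
    forall p s, path e v (rcons p s) -> sigma s < sigma v ->
      (forall x, x \in p -> sigma v < sigma x) -> size p < r ->
      has (mem (X v)) (rcons p s).
Proof.
(* The order is built from the top: a separated vertex of [S] gets the largest rank and is removed.
   Vertices outside [S] have been ranked higher already, so paths may use them freely. *)
suff H n (S : {set V}) : #|S| = n -> exists (sigma : V -> nat) (X : V -> {set V}),
    [/\ {in S &, injective sigma}, forall v, v \in S -> sigma v < n &
    forall v, v \in S -> #|X v| <= q /\
    forall p s, path e v (rcons p s) -> s \in S -> sigma s < sigma v ->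
      (forall x, x \in p -> x \in S -> sigma v < sigma x) -> size p < r ->
      has (mem (X v)) (rcons p s)].
  have [sigma [X [si _ sX]]] := H _ setT erefl.
  exists sigma, X; split=> [x y|v]; first by apply: si; rewrite inE.
  have [-> Xv] := sX v (in_setT v); split=> // p s ps sv px.
  by apply: Xv => // x xp _; exact: px.
elim: n S => [|n IH] S.
  move/eqP; rewrite cards_eq0 => /eqP->.
  by exists (fun _ => 0), (fun _ => set0); split=> [x y|v|v]; rewrite inE.
move=> Sn; have /separated[v [Y [vS Yq Yh]]] : S != set0 by rewrite -card_gt0 Sn.
have [|sigma [X [si sn sX]]] := IH (S :\ v).
  by move: Sn; rewrite (cardsD1 v S) vS => -[].
pose tau x := if x == v then n else sigma x.
have tauv : tau v = n by rewrite /tau eqxx.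
have tauN x : x != v -> tau x = sigma x by rewrite /tau => /negPf->.
have SN x : x \in S -> x != v -> x \in S :\ v by rewrite !inE => -> ->.
have taun x : x \in S -> x != v -> tau x < n.
  by move=> xS xv; rewrite tauN // sn // SN.
exists tau, (fun x => if x == v then Y else X x); split.
- move=> x y xS yS; have [->|xv] := eqVneq x v; have [->|yv] := eqVneq y v => //.
  + by rewrite tauv => E; have := taun y yS yv; rewrite -E ltnn.
  + by rewrite tauv => E; have := taun x xS xv; rewrite E ltnn.
  + by rewrite !tauN //; apply: si; exact: SN.
- move=> x xS; have [->|xv] := eqVneq x v; first by rewrite tauv.
  by rewrite ltnS ltnW // taun.
move=> w wS; have [->|wv] := eqVneq w v.
  split=> // p s ps sS; rewrite tauv => sv px szp; apply: Yh => //.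
    by apply: contraTneq sv => ->; rewrite tauv ltnn.
  move=> x xp; apply/negP => xS; have := px x xp xS.
  have [->|xv] := eqVneq x v; first by rewrite tauv ltnn.
  by rewrite ltnNge ltnW // taun.
have [Xw Hw] := sX w (SN _ wS wv); split=> // p s ps sS sw px szp.
have sv : s != v.
  by apply: contraTneq sw => ->; rewrite tauv -leqNgt ltnW // taun.
apply: Hw => //; first exact: SN.
  by move: sw; rewrite !tauN.
move=> x xp; rewrite !inE => /andP[xv xS].
by have := px x xp xS; rewrite !tauN.
Qed.

Definition high_walk (sigma : V -> nat) k i x u := exists p,
  [/\ path e x p, size p <= i, last x p = u & {in x :: p, forall w, k <= sigma w}].

Definition wreach sigma i x u := high_walk sigma (sigma u) i x u.

Fixpoint wreach_bound i := if i is j.+1 then 1 + q * wreach_bound j else 1.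

(** Cut a walk from [x] to a lower [u] at its first vertex below [x]. The initial segment meets
    [X x] in some [z], and [u] is weakly reachable from [z] by a shorter walk, hence the recursion
    of [wreach_bound]. *)
Lemma weak_coloring_order : exists sigma : V -> nat, injective sigma /\
  forall x, exists2 W : {set V}, #|W| <= wreach_bound r &
    forall u, wreach sigma r x u -> u \in W.
Proof.
have [sigma [X [si sX]]] := separator_order; exists sigma; split=> //.
suff H i : i <= r -> forall x, exists2 W : {set V}, #|W| <= wreach_bound i &
    forall u, wreach sigma i x u -> u \in W by exact: H.
elim: i => [_ x|i IH ir x].
  exists [set x]; first by rewrite cards1.
  by move=> u [[|y p] [_ // _ <- _]]; rewrite inE.
have /choice[W WP] y : exists W : {set V}, #|W| <= wreach_bound i /\
    forall u, wreach sigma i y u -> u \in W.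
  by have [W ? ?] := IH (ltnW ir) y; exists W.
exists (x |: \bigcup_(y in X x) W y).
  apply: leq_trans (leq_card_setU _ _) _; rewrite cards1 leq_add2l.
  have [Xq _] := sX x; apply: leq_trans (leq_mul Xq (leqnn _)); rewrite mulnC.
  by apply: card_bigcup_le => y _; case: (WP y).
move=> u [p [pp szp lp up]].
have [->|ux] := eqVneq u x; first exact: setU11.
have {}lp : last x p == u by rewrite lp.
(* A simple path does not return to [x], so all vertices before the cut are strictly above [x]. *)
move: szp up lp; case/shortenP: pp => p' pp' up' sp' szp up lp.
have {}szp : size p' <= i.+1.
  by apply: leq_trans szp; apply: uniq_leq_size => //; case/andP: up'.
have {}up : {in x :: p', forall w, sigma u <= sigma w}.
  move=> w; rewrite inE => wp; apply: up; rewrite inE.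
  by case/orP: wp => [->//|/sp'->]; rewrite orbT.
have ux' : sigma u < sigma x.
  by rewrite ltn_neqAle up ?mem_head // andbT; apply: contraNneq ux => /si->.
have : has (fun w => sigma w < sigma x) p'.
  apply/hasP; exists u => //; move/eqP: lp ux => <-.
  by case: (p') => [|z s _]; rewrite ?eqxx //= mem_last.
move=> /split_has[p1 [y [p2 [E yx /hasPn p1x]]]].
have [_ Xh] := sX x.
have : has (mem (X x)) (rcons p1 y).
  apply: Xh => //; first by move: pp'; rewrite E -cat_rcons cat_path => /andP[].
    move=> w wp1; rewrite ltn_neqAle leqNgt p1x // andbT.
    apply: contraTneq up' => /si xw; rewrite E /= mem_cat xw wp1 //.
  have := szp; rewrite E size_cat /= => h; apply: leq_trans ir; lia.
move=> /hasP[z zp zX]; rewrite inE; apply/orP; right; apply/bigcupP; exists z => //.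
have [_ ] := WP z; apply.
have /splitPr zs : z \in p'.
  by rewrite E -cat_rcons mem_cat zp.
case: zs pp' up' sp' szp up lp E => q1 q2 pp' up' sp' szp up lp E.
exists q2; split.
- by move: pp'; rewrite cat_path /= => /and3P[].
- by move: szp; rewrite size_cat /=; lia.
- by move/eqP: lp; rewrite last_cat.
- by move=> w wq; apply: up; rewrite inE mem_cat wq !orbT.
Qed.

End WeakReachability.

(** * Posets of bounded height *)

Section HighWalks.
Variables (V : finType) (e : rel V) (sigma : V -> nat).
Hypothesis se : symmetric e.

Lemma high_walk_sym k i x y : high_walk e sigma k i x y -> high_walk e sigma k i y x.
Proof.
move=> [p [pp sp lp hp]]; exists (rev (belast x p)); rewrite -lp rev_path.
split; first by rewrite (@eq_path _ _ e) // => a b; rewrite se.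
- by rewrite size_rev size_belast.
- by case: p {pp sp lp hp} => //= z s; rewrite rev_cons last_rcons.
- move=> z; rewrite inE mem_rev => zi; apply: hp.
  by case/orP: zi => [/eqP->|/mem_belast//]; exact: mem_last.
Qed.

Lemma high_walk_trans k i j x y z : high_walk e sigma k i x y ->
  high_walk e sigma k j y z -> high_walk e sigma k (i + j) x z.
Proof.
move=> [p [pp sp lp hp]] [s [ps ss ls hs]]; exists (p ++ s).
rewrite cat_path last_cat lp pp ps size_cat leq_add //; split=> // w.
rewrite -cat_cons mem_cat => /orP[/hp//|ws]; apply: hs; by rewrite inE ws orbT.
Qed.

Lemma high_walk_mono k k' i i' x y : k' <= k -> i <= i' ->
  high_walk e sigma k i x y -> high_walk e sigma k' i' x y.
Proof.
move=> kk ii [p [pp sp lp hp]]; exists p; split=> //; first exact: leq_trans ii.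
by move=> w /hp; exact: leq_trans.
Qed.

Variables (I : eqType) (phi : V -> I) (n : nat).
Hypothesis phiP : forall u v, wreach e sigma (3 * n) v u -> u != v -> phi u != phi v.

(* [x] and [y] may coincide: then a color occurs at most once among the
   vertices weakly [n]-reachable from [x]. *)
Lemma wreach_same_color x y u w k : high_walk e sigma k n x y ->
  (sigma u <= k) || (sigma w <= k) ->
  wreach e sigma n x u -> wreach e sigma n y w -> phi u = phi w -> u = w.
Proof.
move=> xy uwk xu yw; wlog uw : x y u w xy uwk xu yw / sigma u <= sigma w.
  move=> H; case/orP: (leq_total (sigma u) (sigma w)) => uw; first exact: (H x y u w).
  rewrite orbC in uwk.
  by move=> /esym E; apply/esym; exact: (H y x w u (high_walk_sym xy) uwk yw xu uw E).
have uk : sigma u <= k by case/orP: uwk => // /(leq_trans uw).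
move=> E; apply/eqP; apply: contraT => ne.
(* The walks from [w] to [y], [y] to [x] and [x] to [u] all stay at or above [u]; their total length
   explains the factor 3. *)
suff H : wreach e sigma (3 * n) w u by have := phiP H ne; rewrite E eqxx.
rewrite /wreach (_ : 3 * n = n + (n + n)); last by lia.
apply: high_walk_trans (high_walk_mono uw (leqnn _) (high_walk_sym yw)) _.
by apply: high_walk_trans xu; apply: high_walk_mono (high_walk_sym xy).
Qed.
End HighWalks.

Section BoundedHeight.
Import Order.TTheory.
Variables (d : Order.disp_t) (P : finPOrderType d).
Implicit Types x y z : P.

Definition cover_edge : rel P := fun x y => covers x y || covers y x.

Lemma cover_edge_sym : symmetric cover_edge.
Proof. by move=> x y; rewrite /cover_edge orbC. Qed.

Lemma cover_edge_graph x y : cover_edge x y -> [set x; y] \in cover_graph P.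
Proof.
move=> /orP[] h; rewrite inE; apply/existsP.
  by exists x; apply/existsP; exists y; rewrite h eqxx.
by exists y; apply/existsP; exists x; rewrite h setUC eqxx.
Qed.

Lemma covers_path x y : (x <= y)%O -> exists p, path (@covers d P) x p /\ last x p = y.
Proof.
have [n] := ubnP #|[set z | (x < z <= y)%O]|; elim: n x => // n IH x.
rewrite ltnS => cn; rewrite le_eqVlt => /predU1P[->|xy]; first by exists [::].
have Py : (x < y <= y)%O by rewrite xy lexx.
case: (arg_minnP (P := fun z => (x < z <= y)%O)
  (fun z => #|[set w | (w < z)%O]|) Py) => z /andP[xz zy] zmin.
have xzc : covers x z.
  rewrite /covers xz; apply/existsPn => w; apply/negP => /andP[xw wz].
  have := zmin w; rewrite xw (ltW (lt_le_trans wz zy)) => /(_ isT).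
  rewrite leqNgt => /negP; apply; apply: proper_card; apply/properP; split.
    by apply/fintype.subsetP => a; rewrite !inE => /lt_trans; apply.
  by exists w; rewrite !inE ?wz // ltxx.
have [|p [pp lp]] := IH z _ zy; last by exists (z :: p); rewrite /= xzc.
apply: leq_trans cn; apply: proper_card; apply/properP; split.
  by apply/fintype.subsetP => a; rewrite !inE => /andP[/(lt_trans xz)-> ->].
by exists z; rewrite !inE ?xz ?zy // ltxx.
Qed.

Lemma covers_path_height x p : path (@covers d P) x p -> size p < height P.
Proof.
move=> pp.
have {}pp : path <%O x p by apply: sub_path pp => a b /andP[].
have up : uniq (x :: p) by apply: (sorted_uniq lt_trans ltxx).
rewrite -[_ < _]/(size (x :: p) <= _) -(card_uniqP up) -cardsE /height.
apply: leq_bigmax_cond; apply/forall_inP => a; rewrite inE => ap.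
apply/forall_inP => b; rewrite inE => bp.
have sle : sorted <=%O (x :: p) by apply: sub_path pp => u v; exact: ltW.
have [ab|ba] := leqP (index a (x :: p)) (index b (x :: p)).
  apply/orP; left; have := sorted_leq_index le_trans lexx sle.
  by move=> /(_ a b ap bp ab).
apply/orP; right; have := sorted_leq_index le_trans lexx sle.
by move=> /(_ b a bp ap (ltnW ba)).
Qed.

Lemma covers_path_between x p z : path (@covers d P) x p -> z \in x :: p ->
  (x <= z <= last x p)%O.
Proof.
move=> pp; have {}pp : path <=%O x p by apply: sub_path pp => a b /andP[/ltW].
elim: p x z pp => [|y p IH] x z /=.
  by move=> _; rewrite inE => /eqP->; rewrite !lexx.
move=> /andP[xy yp]; rewrite inE => /predU1P[->|zp].
  have /andP[_ yl] := IH y y yp (mem_head _ _).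
  by rewrite lexx (le_trans xy yl).
by have /andP[yz ->] := IH y z yp zp; rewrite (le_trans xy yz).
Qed.

Variable sigma : P -> nat.

(* [z] is the lowest vertex, in the order [sigma], of a chain from [x] to [y]. *)
Lemma order_low_point x y : (x <= y)%O -> exists z,
  [/\ (x <= z <= y)%O, wreach cover_edge sigma (height P).-1 x z,
      wreach cover_edge sigma (height P).-1 y z &
      high_walk cover_edge sigma (sigma z) (height P).-1 x y].
Proof.
move=> /covers_path[p [pp lp]].
have szp : size p <= (height P).-1.
  by have := covers_path_height pp; case: (height P).
have [z zp zmin] : exists2 z, z \in x :: p & {in x :: p, forall w, sigma z <= sigma w}.
  case: (arg_minnP (P := [in x :: p]) sigma (mem_head x p)) => z zp zmin.
  by exists z.
have pe : path cover_edge x p by apply: sub_path pp => a b; rewrite /cover_edge => ->.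
have btw := covers_path_between pp zp; rewrite lp in btw.
case/splitPl: zp pe zmin szp lp {pp} => p1 p2 l1.
rewrite cat_path l1 last_cat l1 size_cat => /andP[pe1 pe2] zmin szp lp.
exists z; split=> //.
- exists p1; split=> //; first by apply: leq_trans szp; exact: leq_addr.
  by move=> w wp; apply: zmin; rewrite -cat_cons mem_cat wp.
- apply: (high_walk_sym cover_edge_sym); exists p2; split=> //.
    by apply: leq_trans szp; exact: leq_addl.
  move=> w wp; apply: zmin; rewrite -l1 in wp; rewrite -cat_cons mem_cat.
  move: wp; rewrite inE => /predU1P[->|->]; last by rewrite orbT.
  by rewrite mem_last.
- exists (p1 ++ p2); split=> //; rewrite ?size_cat // ?last_cat ?l1 //.
  by rewrite cat_path l1 pe1.
Qed.

End BoundedHeight.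

Lemma exists_min_nat (T : Type) (f : T -> nat) (x0 : T) :
  exists x, forall y, f x <= f y.
Proof.
have [n] := ubnP (f x0); elim: n x0 => // n IH x0; rewrite ltnS => fn.
have [?|/existsNP[y /negP]] := pselect (forall y, f x0 <= f y); first by exists x0.
by rewrite -ltnNge => h; apply: (IH y); apply: leq_trans fn.
Qed.

(** * Pairs with equal signatures form no alternating cycle *)

Section Signatures.
Import Order.TTheory.
Variables (d : Order.disp_t) (P : finPOrderType d).
Implicit Types (x y z : P) (C : pred (P * P)).

Notation edge := (@cover_edge d P).
Variables (sigma : P -> nat) (I : finType) (phi : P -> I).
Let n := (height P).-1.
Hypothesis sigma_inj : injective sigma.
Hypothesis phiP : forall u v, wreach edge sigma (3 * n) v u -> u != v -> phi u != phi v.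

Definition up_reach x t u := [/\ wreach edge sigma n x u, (x <= u)%O & phi u = t].
Definition down_reach y t w := [/\ wreach edge sigma n y w, (w <= y)%O & phi w = t].

Definition signature (p : P * P) : {ffun I -> bool * bool * bool} :=
  [ffun t => (`[< exists u, up_reach p.1 t u >], `[< exists w, down_reach p.2 t w >],
    `[< exists u w, [/\ up_reach p.1 t u, down_reach p.2 t w & sigma u < sigma w] >])].

Lemma high_walk0 x : high_walk edge sigma (sigma x) n x x.
Proof. by exists [::]; split=> // w; rewrite inE => /eqP->. Qed.

Lemma up_reach_inj x t u u' : up_reach x t u -> up_reach x t u' -> u = u'.
Proof.
move=> [xu _ <-] [xu' _ E].
apply: (wreach_same_color (@cover_edge_sym d P) phiP (high_walk0 x)) => //.
by have [p [_ _ _ h]] := xu; rewrite h ?mem_head.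
Qed.

Lemma down_reach_inj y t w w' : down_reach y t w -> down_reach y t w' -> w = w'.
Proof.
move=> [xu _ <-] [xu' _ E].
apply: (wreach_same_color (@cover_edge_sym d P) phiP (high_walk0 y)) => //.
by have [p [_ _ _ h]] := xu; rewrite h ?mem_head.
Qed.

Lemma signature_eq p q t : signature p = signature q ->
  [/\ (exists u, up_reach p.1 t u) -> exists u, up_reach q.1 t u,
      (exists w, down_reach p.2 t w) -> exists w, down_reach q.2 t w &
      (exists u w, [/\ up_reach p.1 t u, down_reach p.2 t w & sigma u < sigma w]) ->
      exists u w, [/\ up_reach q.1 t u, down_reach q.2 t w & sigma u < sigma w]].
Proof.
move=> /(congr1 (fun h : {ffun I -> bool * bool * bool} => h t)); rewrite !ffunE.
by case=> e1 e2 e3; split=> /asboolP; rewrite ?e1 ?e2 ?e3 => /asboolP.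
Qed.

Lemma no_alternating_cycle (f : nat -> P * P) m : 0 < m ->
  (forall i, f (i + m) = f i) -> (forall i j, signature (f i) = signature (f j)) ->
  (forall i, ~~ ((f i).1 <= (f i).2)%O) -> (forall i, ((f i).1 <= (f i.+1).2)%O) ->
  False.
Proof.
move=> m0 per sig inc alt.
have /choice[zf zfP] (p : P * P) : exists z, (p.1 <= p.2)%O ->
    [/\ (p.1 <= z <= p.2)%O, wreach edge sigma n p.1 z,
      wreach edge sigma n p.2 z & high_walk edge sigma (sigma z) n p.1 p.2].
  have [le|_] := boolP (p.1 <= p.2)%O; last by exists p.1.
  by have [z ?] := order_low_point sigma le; exists z.
pose z i := zf ((f i).1, (f i.+1).2).
have zP i := zfP ((f i).1, (f i.+1).2) (alt i).
have perz i k : z (i + k * m) = z i.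
  elim: k => [|k <-]; first by rewrite addn0.
  by rewrite mulSn addnCA addnC /z -addSn !per.
have [i0 min0] := exists_min_nat (fun i => sigma (z i)) 0.
pose t := phi (z i0); pose mu := sigma (z i0).
have up_z i : phi (z i) = t -> up_reach (f i).1 t (z i).
  by have [/andP[? _] ? _ _] := zP i.
have dn_z i : phi (z i) = t -> down_reach (f i.+1).2 t (z i).
  by have [/andP[_ ?] _ ? _] := zP i.
have /choice[u uP] i : exists u, up_reach (f i).1 t u.
  by have [H _ _] := signature_eq t (sig i0 i); apply: H; exists (z i0); exact: up_z.
have /choice[w wP] i : exists w, down_reach (f i).2 t w.
  have [_ H _] := signature_eq t (sig i0.+1 i).
  by apply: H; exists (z i0); exact: dn_z.
(* The walk between the two ends stays at or above [mu], so a vertex of color [t] this low that is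
   weakly reachable from one end is identified with the one of the other end. *)
have link i : (sigma (u i) <= mu) || (sigma (w i.+1) <= mu) -> u i = w i.+1.
  have [_ _ _ hz] := zP i; have [xu _ eu] := uP i; have [yw _ ew] := wP i.+1.
  move=> H; apply: (wreach_same_color (@cover_edge_sym d P) phiP hz _ xu yw).
    by case/orP: H => /leq_trans/(_ (min0 i))->; rewrite ?orbT.
  by rewrite eu ew.
have neq i : sigma (u i) != sigma (w i).
  apply/eqP => /sigma_inj E; have [_ xu _] := uP i; have [_ wy _] := wP i.
  by move: (inc i); rewrite (le_trans xu) // E.
have uz i : phi (z i) = t -> u i = z i by move=> /up_z; exact: up_reach_inj.
have wz i : phi (z i) = t -> w i.+1 = z i by move=> /dn_z; exact: down_reach_inj.
have lt_all i j : sigma (u i) < sigma (w i) -> sigma (u j) < sigma (w j).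
  move=> uw; have [_ _ H] := signature_eq t (sig i j).
  have [|u' [w' [uj wj lt]]] := H; first by exists (u i), (w i).
  by rewrite (up_reach_inj (uP j) uj) (down_reach_inj (wP j) wj).
(* [u i] and [w i] differ and compare the same way for all [i]. Start at [z i0], which is both
   [u i0] and [w i0.+1]: alternating [link] with this comparison, forwards or backwards along the
   cycle, descends forever below [mu]. *)
have [lt0|ge0] := ltnP (sigma (u i0)) (sigma (w i0)).
  have desc k : sigma (u (i0 + k)) + k <= mu.
    elim: k => [|k IH]; first by rewrite !addn0 uz.
    have E : u (i0 + k) = w (i0 + k).+1.
      by apply: link; rewrite (leq_trans _ IH) ?leq_addr.
    have := lt_all i0 (i0 + k).+1 lt0; rewrite -E addnS.
    by move: IH; rewrite -addnS; lia.
  by have := desc mu.+1; lia.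
(* Shifting by whole periods leaves room for [mu.+1] backward steps among natural indices. *)
pose j0 := i0 + mu.+1 * m.
have zj0 : z j0 = z i0 by exact: perz.
have gt_all i : sigma (w i) < sigma (u i).
  rewrite ltn_neqAle eq_sym neq /= leqNgt; apply/negP => h.
  by have := lt_all i i0 h; rewrite ltnNge ge0.
have desc k : k <= j0.+1 -> sigma (w (j0.+1 - k)) + k <= mu.
  elim: k => [_|k IH kj]; first by rewrite addn0 subn0 wz zj0.
  have {}IH := IH (ltnW kj).
  rewrite subSS; have E : j0.+1 - k = (j0 - k).+1 by rewrite subSn.
  rewrite E in IH.
  have E' : u (j0 - k) = w (j0 - k).+1.
    by apply: link; rewrite [X in _ || X](leq_trans _ IH) ?leq_addr ?orbT.
  by have := gt_all (j0 - k); rewrite E'; lia.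
by have := desc mu.+1; rewrite /j0; nia.
Qed.

End Signatures.

(** * Linear extensions reversing a class of pairs *)

Section Reversal.
Import Order.TTheory.
Variables (d : Order.disp_t) (P : finPOrderType d) (C : pred (P * P)).
Implicit Types (x y z : P) (p : P * P) (c : seq (P * P)).

Definition alternates : rel (P * P) := fun p q => (p.1 <= q.2)%O.

Hypothesis no_cycle : forall p c, all C (p :: c) -> ~~ cycle alternates (p :: c).

Definition reversed_step : rel P := fun a b => (a <= b)%O || C (b, a).

(** Successive reversals on a walk are separated by comparabilities, so they form an alternating
    path; a closed walk with a reversal would give an alternating cycle. *)
Lemma connect_reversed_step a b : connect reversed_step a b -> (a <= b)%O \/
  exists p c, [/\ all C (p :: c), path alternates p c, (a <= p.2)%O &
                  ((last p c).1 <= b)%O].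
Proof.
move=> /connectP[s ps ->]; elim: s a ps => [|a1 s IH] a /=; first by left.
move=> /andP[/orP[aa1|Ca] /IH[le|[p [c [Cc pc ap lb]]]]].
- by left; exact: le_trans le.
- by right; exists p, c; split=> //; exact: le_trans ap.
- by right; exists (a1, a), [::]; rewrite /= Ca; split.
- right; exists (a1, a), (p :: c); split=> //; first by rewrite /= Ca.
  by rewrite /= pc andbT.
Qed.

Lemma reversed_step_antisym a b :
  connect reversed_step a b -> connect reversed_step b a -> a = b.
Proof.
have closed p c : all C (p :: c) -> path alternates p c ->
    ((last p c).1 <= p.2)%O -> False.
  move=> Cc pc lp; have /negP := no_cycle Cc; apply.
  by rewrite /= rcons_path pc.
move=> /connect_reversed_step[ab|[p [c [Cc pc ap lb]]]].
  move=> /connect_reversed_step[ba|[p [c [Cc pc bp la]]]].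
    by apply: le_anti; rewrite ab.
  by case: (closed p c Cc pc); apply: le_trans la (le_trans ab bp).
move=> /connect_reversed_step[ba|[p' [c' [Cc' pc' bp' la]]]].
  by case: (closed p c Cc pc); apply: le_trans lb (le_trans ba ap).
case: (closed p (c ++ p' :: c')).
- by move: Cc Cc'; rewrite /= all_cat /= => /andP[-> ->] /andP[-> ->].
- by rewrite cat_path pc /= pc' andbT; exact: le_trans bp'.
- by rewrite last_cat /=; exact: le_trans ap.
Qed.

Lemma reversing_extension : exists L : {set P * P}, linear_extension L /\
  forall x y, C (x, y) -> ~~ (x <= y)%O -> (x, y) \notin L.
Proof.
(* Counting predecessors linearizes the acyclic relation; ties are broken by [enum_rank]. *)
pose rk z := #|[set w | connect reversed_step w z]|.
pose key z := rk z * #|P| + enum_rank z.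
have key_lt a b : connect reversed_step a b -> a != b -> key a < key b.
  move=> ab ne; have h : rk a < rk b.
    apply: proper_card; apply/properP; split.
      by apply/fintype.subsetP => w; rewrite !inE => /connect_trans; apply.
    exists b; rewrite !inE ?connect0 //.
    by apply: contra ne => ba; apply/eqP/reversed_step_antisym.
  rewrite /key; apply: (@leq_trans ((rk a).+1 * #|P|)).
    by rewrite mulSn addnC ltn_add2r; exact: ltn_ord.
  by rewrite (leq_trans _ (leq_addr _ _)) // leq_mul2r h orbT.
have key_inj : injective key.
  move=> a b E; apply: enum_rank_inj; apply: val_inj => /=.
  have := congr1 (modn^~ #|P|) E; rewrite /key !modnMDl.
  by rewrite !modn_small ?ltn_ord.
exists [set p | key p.1 <= key p.2]; split; last first.
  move=> x y Cxy nxy; rewrite inE -ltnNge; apply: key_lt.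
    by apply: connect1; rewrite /reversed_step Cxy orbT.
  by apply: contraNneq nxy => /= ->; rewrite lexx.
apply/and4P; split.
- apply/forallP => x; apply/forallP => y; rewrite !inE /=; apply/implyP => h.
  by apply/eqP/key_inj/eqP; rewrite eqn_leq.
- apply/forallP => x; apply/forallP => y; apply/forallP => z; rewrite !inE /=.
  by apply/implyP => /andP[]; exact: leq_trans.
- by apply/forallP => x; apply/forallP => y; rewrite !inE /= leq_total.
apply/fintype.subsetP => -[x y]; rewrite !inE /= => xy.
have [->//|ne] := eqVneq x y; apply/ltnW/key_lt => //.
by apply: connect1; rewrite /reversed_step xy.
Qed.

End Reversal.

Section Dimension.
Import Order.TTheory.
Variables (d : Order.disp_t) (P : finPOrderType d).

(** One extension per value of [s] suffices: each pair outside the order, including those with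
    [y < x], is excluded by the extension of its class. *)
Lemma poset_dim_le (S : finType) (s : P * P -> S) : 0 < #|S| ->
  (forall a p c, all (fun q => ~~ (q.1 <= q.2)%O && (s q == a)) (p :: c) ->
     ~~ cycle (@alternates d P) (p :: c)) ->
  poset_dim P <= #|S|.
Proof.
move=> S0 H; rewrite /poset_dim; case: ex_minnP => m _; apply.
rewrite /has_realizer S0 /=.
have /choice[L LP] a := reversing_extension (H a).
apply/existsP; exists [ffun i => L (enum_val i)]; apply/andP; split.
  by apply/forallP => i; rewrite ffunE; case: (LP (enum_val i)).
apply/eqP/setP => -[x y]; apply/bigcapP/idP => [h|xy i _].
  rewrite inE /=; apply: contraT => nxy.
  have := h (enum_rank (s (x, y))) isT; rewrite ffunE enum_rankK.
  have [_ Lr] := LP (s (x, y)).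
  by rewrite (negPf (Lr x y _ nxy)) // nxy eqxx.
rewrite ffunE; have [/and4P[_ _ _ /fintype.subsetP sub] _] := LP (enum_val i).
exact: sub.
Qed.

Lemma dim_le_signatures (sigma : P -> nat) (I : finType) (phi : P -> I) :
  injective sigma ->
  (forall u v, wreach (@cover_edge d P) sigma (3 * (height P).-1) v u -> u != v ->
     phi u != phi v) ->
  poset_dim P <= #|{: {ffun I -> bool * bool * bool}}|.
Proof.
move=> si phiP; apply: (@poset_dim_le _ (signature sigma phi)).
  by apply/card_gt0P; exists [ffun=> (true, true, true)].
move=> a p c Cc; apply/negP => cyc.
pose s := p :: c; pose m := size s.
have inC i : nth p s (i %% m) \in s by rewrite mem_nth // ltn_mod.
(* The cycle is unrolled into a periodic sequence. *)
apply: (@no_alternating_cycle d P sigma I phi si phiP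
  (fun i => nth p s (i %% m)) m) => //.
- by move=> i; rewrite modnDr.
- by move=> i j; have /andP[_ /eqP->] := allP Cc _ (inC i);
    have /andP[_ /eqP->] := allP Cc _ (inC j).
- by move=> i; have /andP[] := allP Cc _ (inC i).
move=> i; have im : i %% m < m by rewrite ltn_mod.
have := cyc; rewrite /cycle => /(pathP p)/(_ (i %% m)).
rewrite size_rcons => /(_ im); rewrite /alternates.
have -> : nth p (p :: rcons c p) (i %% m) = nth p s (i %% m).
  by rewrite -rcons_cons nth_rcons im.
rewrite nth_rcons; case: ltnP => h.
  by rewrite -[i.+1]addn1 -modnDml addn1 [(i %% m).+1 %% m]modn_small.
have E : i %% m = size c by apply/eqP; rewrite eqn_leq h andbT -ltnS.
rewrite E eqxx => H; suff -> : i.+1 %% m = 0 by [].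
by rewrite -[i.+1]addn1 -modnDml addn1 E modnn.
Qed.

End Dimension.

(** * Curves in the plane *)

From mathcomp Require Import all_classical all_reals all_analysis.

Section Curves.
Import Order.TTheory GRing.Theory Num.Theory numFieldNormedType.Exports.
Local Open Scope classical_set_scope.
Local Open Scope ring_scope.
Variable R : realType.
Implicit Types (K L : set (R * R)) (d : R).

Lemma ball_nearby (z w : R * R) d : ball z d w <-> nearby d z w.
Proof.
split; first by case=> /= a b; apply/andP.
by move=> /andP[a b]; split.
Qed.

(** The set of points reached by chains is open and closed in [K], because it absorbs every point of
    [K] within [d] of it. *)
Lemma connected_chain K d (x y : R * R) : connected K -> 0 < d -> K x -> K y ->
  exists s, [/\ path (nearby d) x s, last x s = y & {in x :: s, forall z, K z}].
Proof.
move=> cK d0 Kx Ky.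
pose B := [set z | exists s, [/\ path (nearby d) x s, last x s = z &
  {in x :: s, forall z, K z}]].
have BK z : B z -> K z by case=> s [_ <- H]; apply: H; exact: mem_last.
have ext z w : B z -> K w -> nearby d z w -> B w.
  move=> [s [ps ls sK]] Kw zw; exists (rcons s w); split.
  - by rewrite rcons_path ps ls.
  - by rewrite last_rcons.
  - move=> u; rewrite -rcons_cons mem_rcons inE => /orP[/eqP->//|]; exact: sK.
suff : B = K by move=> e; have : B y by rewrite e.
have nb (z : R * R) : nbhs z [set w | nearby d z w].
  by apply/nbhs_ballP; exists d => //= w /ball_nearby.
apply: cK; first by exists x; exists [::]; split=> // u; rewrite inE => /eqP->.
  exists (\bigcup_(z in B) (ball z d)°).
    by apply: bigcup_open => z _; exact: open_interior.
  apply/seteqP; split=> [z Bz|z [Kz [w Bw wz]]].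
    split; first exact: BK.
    exists z => //; apply: filterS (nb z) => w; exact: (ball_nearby _ _ _).2.
  by apply: ext Bw Kz _; apply/ball_nearby; exact: interior_subset wz.
exists (closure B); first exact: closed_closure.
apply/seteqP; split=> [z Bz|z [Kz cz]].
  by split; [exact: BK|exact: subset_closure].
have [w [Bw zw]] := cz _ (nb z).
by apply: ext Bw Kz _; rewrite nearbyC.
Qed.

(** Near each point of [K] some threshold works against all of [L], as the complement of [L] is
    open; compactness of [K] makes it uniform. *)
Lemma compact_far K L : compact K -> compact L -> K `&` L = set0 ->
  exists2 d, 0 < d & forall z w, K z -> L w -> far d z w.
Proof.
move=> cK cL KL.
have clL : closed L.
  by apply: compact_closed cL; exact: norm_hausdorff.
have /compact_near_coveringP/(_ R 0^'+ (fun d z => forall w, L w -> far d z w)) := cK.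
have H z : K z -> \forall z' \near z & d \near 0^'+, forall w, L w -> far d z' w.
  move=> Kz.
  have : nbhs z (~` L).
    apply: open_nbhs_nbhs; split; first exact: closed_openC.
    by move=> Lz; have : (K `&` L) z by []; rewrite KL.
  move=> /nbhs_ballP[e /= e0 be].
  exists ([set z' | nearby (e / 2) z z'], [set d | d < e / 2]) => /=.
    split.
      apply/nbhs_ballP; exists (e / 2) => [|w /ball_nearby //].
      by rewrite /= divr_gt0.
    by apply: nbhs_right_lt; rewrite divr_gt0.
  move=> [z' d] /= [zz' de] w Lw; apply/negPn/negP; rewrite /far negb_or -!ltNge.
  move=> /andP[a b]; apply: (be w) Lw; apply/ball_nearby.
  move: zz' => /andP[a' b']; apply/andP; split.
    by move: a a'; rewrite !ltr_norml => /andP[? ?] /andP[? ?]; apply/andP; split; lra.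
  by move: b b'; rewrite !ltr_norml => /andP[? ?] /andP[? ?]; apply/andP; split; lra.
move=> /(_ _ H) {}H.
have : \forall d \near 0^'+, 0 < d /\ K `<=` (fun z => forall w, L w -> far d z w).
  by apply: filterI => //; exact: nbhs_right_gt.
by move=> /filter_ex[d [d0 Kd]]; exists d => // z w Kz; exact: Kd.
Qed.

End Curves.

Lemma far_weak (R : realType) (d e : R) z w : (d <= e)%R -> far e z w -> far d z w.
Proof.
by move=> de /orP[] h; rewrite /far (Order.POrderTheory.le_trans de h) ?orbT.
Qed.

(** * From drawings to chains of points *)

Section KPlanar.
Import Order.TTheory GRing.Theory Num.Theory numFieldNormedType.Exports.
Local Open Scope classical_set_scope.
Local Open Scope ring_scope.
Variables (R : realType) (V : finType) (E : {set {set V}}).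

(* [K A] is the curve of the edge [A]; [X] relates crossing edges. *)
Lemma k_planar_chains (k : nat) : k_planar R E k ->
  exists (v : V -> R * R) (K : {set V} -> set (R * R)) (X : rel {set V}) (d : R),
  [/\ 0 < d,
      forall x y, [set x; y]%SET \in E -> exists s,
        [/\ path (nearby d) (v x) s, last (v x) s = v y &
            {in v x :: s, forall z, K [set x; y]%SET z}],
      forall A B, A \in E -> B \in E -> (forall x, x \in A -> x \notin B) -> ~~ X A B ->
        forall z w, K A z -> K B w -> far (d *+ 2) z w,
      symmetric X &
      forall A, A \in E -> (#|[set B in E | X A B]%SET| <= k)%N].
Proof.
move=> [v [c [D cr]]].
pose meet A B := edge_interior c A `&` edge_interior c B.
pose X A B := `[< A <> B /\ meet A B !=set0 >].
(* A curve passes through no vertices but its own, so curves of disjoint edges can only meet at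
   interior points of both, which are crossings. *)
have KX A B : A \in E -> B \in E -> (forall x, x \in A -> x \notin B) -> ~~ X A B ->
    edge_curve c A `&` edge_curve c B = set0.
  move=> AE BE dAB nX; apply/seteqP; split=> // z [].
  have endp A' t : A' \in E -> (`[0, 1] t)%classic -> (`]0, 1[ t)%classic \/
      exists2 x, x \in A' & c A' t = v x.
    move=> A'E; rewrite /= !in_itv /= => /andP[t0 t1].
    have E' : [set c A' 0; c A' 1] = v @` [set` A'] := drawing_endpoints D A'E.
    move: t0; rewrite le_eqVlt => /orP[/eqP<-|t0].
      have : [set c A' 0; c A' 1] (c A' 0) by left.
      by rewrite E' => -[x /= xA <-]; right; exists x.
    move: t1; rewrite le_eqVlt => /orP[/eqP->|t1].
      have : [set c A' 0; c A' 1] (c A' 1) by right.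
      by rewrite E' => -[x /= xA <-]; right; exists x.
    by left; rewrite t0 t1.
  move=> [s s01 <-] [t t01 ts].
  case: (endp A s AE s01) => [s01'|[x xA cx]]; last first.
    have xB : x \in B.
      by apply: (drawing_avoids D BE); rewrite -cx -ts; exists t.
    by move: (dAB x xA); rewrite xB.
  case: (endp B t BE t01) => [t01'|[x xB cx]]; last first.
    have xA : x \in A.
      by apply: (drawing_avoids D AE); rewrite -cx ts; exists s.
    by move: (dAB x xA); rewrite xB.
  move/negP: nX; apply; apply/asboolP; split.
    move=> e; have : edge_curve c A (c A s) by exists s.
    have [x /= xA] : exists x, x \in A.
      have : [set c A 0; c A 1] (c A 0) by left.
      by rewrite (drawing_endpoints D AE) => -[x /= xA _]; exists x.
    by move: (dAB x xA); rewrite -e xA.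
  by exists (c A s); split; [exists s|exists t].
have cptK A : A \in E -> compact (edge_curve c A).
  move=> AE; apply: continuous_compact; first exact: drawing_continuous D _ AE.
  exact: segment_compact.
have [d d0 dfar] : exists2 d, 0 < d & forall A B, A \in E -> B \in E ->
    (forall x, x \in A -> x \notin B) -> ~~ X A B ->
    forall z w, edge_curve c A z -> edge_curve c B w -> far (d *+ 2) z w.
  have H (p : {set V} * {set V}) : exists2 d, 0 < d &
      p.1 \in E -> p.2 \in E -> (forall x, x \in p.1 -> x \notin p.2) -> ~~ X p.1 p.2 ->
      forall z w, edge_curve c p.1 z -> edge_curve c p.2 w -> far (d *+ 2) z w.
    case: (pselect [/\ p.1 \in E, p.2 \in E,
        (forall x, x \in p.1 -> x \notin p.2) & ~~ X p.1 p.2]).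
      move=> [AE BE dAB nX].
      have [d d0 Hd] := compact_far (cptK _ AE) (cptK _ BE) (KX _ _ AE BE dAB nX).
      exists (d / 2) => [|_ _ _ _ z w]; first by rewrite divr_gt0.
      by rewrite -(mulr_natr (d / 2)) divfK ?pnatr_eq0 //; exact: Hd.
    by move=> N; exists 1 => // *; case: N.
  pose f p := xget 0 [set d | 0 < d /\ (p.1 \in E -> p.2 \in E ->
    (forall x, x \in p.1 -> x \notin p.2) -> ~~ X p.1 p.2 ->
    forall z w, edge_curve c p.1 z -> edge_curve c p.2 w -> far (d *+ 2) z w)].
  have Hf p : 0 < f p /\ (p.1 \in E -> p.2 \in E ->
    (forall x, x \in p.1 -> x \notin p.2) -> ~~ X p.1 p.2 ->
    forall z w, edge_curve c p.1 z -> edge_curve c p.2 w ->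
    far (f p *+ 2) z w).
    by rewrite /f; case: xgetP => [d -> //|N]; have [d ? ?] := H p; case: (N d).
  exists (\big[Order.min/1]_p f p).
    by apply: lt_bigmin => // p _; case: (Hf p).
  move=> A B AE BE dAB nX z w Az Bw.
  apply: far_weak ((Hf (A, B)).2 AE BE dAB nX z w Az Bw).
  by rewrite lerMn2r /= bigmin_le.
exists v, (edge_curve c), X, d; split=> //.
- move=> x y AE; set A := [set x; y]%SET in AE *.
  have vK u : u \in A -> edge_curve c A (v u).
    move=> uA; have : (v @` [set` A]) (v u) by exists u.
    rewrite -(drawing_endpoints D AE) => -[->|->]; [exists 0|exists 1] => //=;
    by rewrite in_itv /= lexx ler01.
  apply: connected_chain => //; try (by apply: vK; rewrite !inE eqxx ?orbT).
  apply: connected_continuous_connected; first exact: segment_connected.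
  exact: drawing_continuous D _ AE.
- move=> A B; apply/asboolP/asboolP => -[ne [z [a b]]];
  by split; [move/esym|exists z].
- move=> A AE; set T := [set B in E | X A B]%SET.
  (* Choosing one crossing point for each edge that crosses [A] is injective, since no point lies
     inside three edges; so the bound on crossing points bounds the edges. *)
  pose g B := xget 0 (meet A B).
  have gP B : B \in T -> [/\ B \in E, B != A & meet A B (g B)].
    rewrite inE => /andP[BE /asboolP[ne [z mz]]].
    split=> //; first by apply/eqP => /esym.
    by rewrite /g; case: xgetP => [? -> //|N]; case: (N z).
  pose f i := g (nth A (enum T) i).
  have nT i : (i < #|T|)%N -> nth A (enum T) i \in T.
    by move=> iT; rewrite -mem_enum mem_nth // -cardE.
  rewrite -card_le_II; apply: card_le_trans (cr A AE).
  rewrite -(card_le_eql (_ : f @` `I_#|T| #= `I_#|T|)%card); last first.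
    apply: inj_card_eq => i j /set_mem /= iT /set_mem /= jT fij.
    have [BE BA mB] := gP _ (nT i iT); have [CE CA mC] := gP _ (nT j jT).
    have [eBC|neBC] := eqVneq (nth A (enum T) i) (nth A (enum T) j).
      by move/eqP: eBC; rewrite nth_uniq -?cardE // ?enum_uniq// => /eqP.
    have BA' := BA; rewrite eq_sym in BA'; have CA' := CA; rewrite eq_sym in CA'.
    have := drawing_no_triple D AE BE CE BA' CA' neBC.
    move/seteqP => -[/(_ (f i))]; case; split; first exact: mB.
    by rewrite fij; case: mC.
  apply: subset_card_le => z [i /= iT <-].
  by have [BE BA mB] := gP _ (nT i iT); exists (nth A (enum T) i).
Qed.
End KPlanar.

(** * The explicit bound *)

Section DimensionBound.
Variables (k h : nat).

(** A chain of covers has at most [h.-1] steps, and [wreach_same_color] joins three walks of this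
    length. Links in [path_density] have up to [2 * reach] inner vertices because two links of size
    [reach] get spliced. *)
Let reach := 3 * h.-1.
Let path_density := (k * (2 * reach).+1).+1 * minor_density 6.
Let colors := wreach_bound (sep_size path_density reach) reach.

Definition dim_bound := #|{: {ffun 'I_colors.+1 -> bool * bool * bool}}|.

Lemma k_planar_dim_le (R : realType) (d : Order.disp_t) (P : finPOrderType d) :
  height P = h -> k_planar R (cover_graph P) k -> poset_dim P <= dim_bound.
Proof.
move=> hP /k_planar_chains[v [K [X [dl [dl0 chainK farK symX cardX]]]]].
have sparse (M : {set P}) F : linkage (@cover_edge d P) (2 * reach) M F ->
    #|F| <= path_density * #|M|.
  rewrite /path_density -mulnA.
  exact: (linkage_card dl0 (@cover_edge_graph d P) chainK farK symX cardX).
have [sigma [si W]] := weak_coloring_order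
  (exists_separated (@cover_edge_sym d P) sparse).
have /choice[N NP] x : exists N : {set P}, #|N| <= colors /\
    forall u, wreach (@cover_edge d P) sigma reach x u -> u \in N.
  by have [N ? ?] := W x; exists N.
have [phi phiP] := greedy_coloring si (fun x => (NP x).1).
apply: (dim_le_signatures (phi := phi) si) => u x; rewrite hP => xu ne.
apply: phiP; first exact: (NP x).2.
have [p [_ _ _ hi]] := xu; rewrite ltn_neqAle hi ?mem_head // andbT.
by apply: contraNneq ne => /si->.
Qed.

End DimensionBound.

Theorem mainTheorem3 :
  exists g : nat -> nat -> nat,
    forall (k h : nat), (1 <= h)%N ->
    forall (R : realType) (d : Order.disp_t) (P : finPOrderType d),
      height P = h ->
      k_planar R (cover_graph P) k ->
      (poset_dim P <= g k h)%N.
Proof.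
exists dim_bound => k h _ R d P; exact: k_planar_dim_le.
Qed.
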